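(* Let $D$ be a linear differential operator of order $k\ge0$, let $K(\mathbf{x},\mathbf{y})=\Phi_{d,n}(\mathbf{x}-\mathbf{y})$, $\mathbf{x},\mathbf{y}\in\mathbb{R}^d$, where $\Phi_{d,n}$ is Wendland's compactly supported radial basis function with some integer $n\ge k$, and let $s\ge0$ be an integer. Let $\mathbf{z}\in\mathbb{R}^d$ and let $\mathbf{X}=\{\mathbf{x}_1,\ldots,\mathbf{x}_N\}\subset\mathbb{R}^d$ be a finite set of (distinct) points. If $s>0$, assume that there is at least one $w\in\mathbb{R}^N$ with $\sum_{j=1}^Nw_jp(\mathbf{x}_j)=Dp(\mathbf{z})$ for all $p\in\Pi^d_s$. Let $w^*$ be the weight vector of the kernel-based numerical differentiation formula for $D$, $K$, $s$, $\mathbf{z}$, $\mathbf{X}$. Then for all $f\in\mathcal{F}_K$, $$\Big|Df(\mathbf{z})-\sum_{j=1}^Nw_j^*f(\mathbf{x}_j)\Big|\le\rho_{q,D}\big(\mathbf{z},\mathbf{X},n+\tfrac12\big)\,C_{d,2n}^{1/2}\,|\Phi_{d,n}|_{C^{2n,1}(B_{\mathbf{z},\mathbf{X}})}^{1/2}\,\|f\|_K,$$ where $q=\max\{s,n+1\}$ and $$C_{d,2n}=\frac{2d^{n}}{(\frac12+1)^2\cdots(\frac12+n)^2}$$ (an empty product being $1$).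
   Context: Wendland's functions. $\Phi_{d,n}(\mathbf{x})=\varphi_{d,n}(\|\mathbf{x}\|_2)$, $n=0,1,\ldots$, where $\varphi_{d,n}=\mathcal{I}^n\phi_{\lfloor d/2\rfloor+n+1}$ with $\phi_\ell(t)=(1-t)_+^\ell$ for $t\ge 0$ and $(\mathcal{I}\varphi)(t)=\int_t^\infty\tau\varphi(\tau)\,d\tau$, $t\ge0$. Known fact: $K$ is strictly positive definite on $\mathbb{R}^d$, hence conditionally positive definite of every order $s\ge0$, i.e. $\sum_{i,j=1}^ma_ia_jK(\mathbf{y}_i,\mathbf{y}_j)>0$ for all pairwise distinct $\mathbf{y}_1,\ldots,\mathbf{y}_m\in\mathbb{R}^d$ and all $a\in\mathbb{R}^m\setminus\{0\}$ with $\sum_ja_jp(\mathbf{y}_j)=0$ for all $p\in\Pi^d_s$. Notation. $\Pi^d_q$ is the space of $d$-variate real polynomials of total degree at most $q-1$ ($\Pi^d_0=\{0\}$). $S_{\mathbf{z},\mathbf{X}}:=\bigcup_{i=1}^N[\mathbf{z},\mathbf{x}_i]$ is the union of closed line segments, and $B_{\mathbf{z},\mathbf{X}}$ is the closed ball in $\mathbb{R}^d$ centered at the origin with radius equal to the diameter of $S_{\mathbf{z},\mathbf{X}}$. Differential operator: $Df=\sum_{|\alpha|\le k}a_\alpha\partial^\alpha f$ with real variable coefficients $a_\alpha$ (functions). $D'K$ denotes $D$ applied to the first $d$-dimensional argument of $K$. Hölder space. For an integer $r\ge0$ and $0<\gamma\le1$, $C^{r,\gamma}(\Omega)$ consists of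 all $r$ times continuously differentiable functions $f$ on $\Omega\subset\mathbb{R}^d$ with $|f|_{C^{r,\gamma}(\Omega)}:=\max_{|\alpha|=r}|\partial^\alpha f|_{C^{0,\gamma}(\Omega)}<\infty$, where $|g|_{C^{0,\gamma}(\Omega)}:=\sup_{\mathbf{x},\mathbf{y}\in\Omega,\,\mathbf{x}\ne\mathbf{y}}|g(\mathbf{x})-g(\mathbf{y})|/\|\mathbf{x}-\mathbf{y}\|_2^\gamma$. Kernel-based formula. Let $p_1,\ldots,p_M$ be a basis of $\Pi^d_s$ ($M=\binom{d+s-1}{d}$, and $M=0$ if $s=0$). The weight vector $w^*$ is the $w$-part of a solution $(w,v)\in\mathbb{R}^N\times\mathbb{R}^M$ of $$\sum_{j=1}^N w_jK(\mathbf{x}_i,\mathbf{x}_j)+\sum_{j=1}^M v_jp_j(\mathbf{x}_i)=D'K(\mathbf{z},\mathbf{x}_i)\ (1\le i\le N),\qquad \sum_{j=1}^N w_jp_i(\mathbf{x}_j)=Dp_i(\mathbf{z})\ (1\le i\le M).$$ It is known that if the second group of equations is consistent (which is void for $s=0$), then the whole system is solvable and $w^*$ is uniquely determined ($v$ may be non-unique). Native space. $\mathcal{F}_K$ (for the chosen order $s$) is the semi-Hilbert space of real-valued functions on $\mathbb{R}^d$ obtained as completion of the space of functions $\sum_ia_iK(\cdot,\mathbf{y}_i)+p$ (finite sums, $p\in\Pi^d_s$, $\sum_ia_iq(\mathbf{y}_i)=0$ for all $q\in\Pi^d_s$) with squared semi-norm $\|\sum_ia_iK(\cdot,\mathbf{y}_i)+p\|_K^2=\sum_{i,j}a_ia_jK(\mathbf{y}_i,\mathbf{y}_j)$;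 polynomials in $\Pi^d_s$ have semi-norm zero. Equivalently, $f:\mathbb{R}^d\to\mathbb{R}$ belongs to $\mathcal{F}_K$ with $\|f\|_K\le C$ iff $|\sum_ia_if(\mathbf{y}_i)|\le C(\sum_{i,j}a_ia_jK(\mathbf{y}_i,\mathbf{y}_j))^{1/2}$ for all finite sets of points $\mathbf{y}_i$ and coefficients $a_i$ with $\sum_ia_iq(\mathbf{y}_i)=0$ for all $q\in\Pi^d_s$. Growth function. For $\mu\ge0$, $\rho_{q,D}(\mathbf{z},\mathbf{X},\mu):=\sup\{Dp(\mathbf{z}):p\in\Pi^d_q,\ |p(\mathbf{x}_j)|\le\|\mathbf{x}_j-\mathbf{z}\|_2^\mu,\ j=1,\ldots,N\}\in[0,\infty]$; if it equals $\infty$ the bound is void. *)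

(* Defs.v *)
From mathcomp Require Import all_boot all_order all_algebra.
From mathcomp Require Import all_classical all_reals all_analysis.
(* without its notations, which clash with those of mathcomp-analysis *)
From mathcomp Require Import -(notations) mpoly.

Set Implicit Arguments.
Unset Strict Implicit.
Unset Printing Implicit Defensive.

Import Order.TTheory GRing.Theory Num.Theory.
Import numFieldNormedType.Exports.

Local Open Scope classical_set_scope.
Local Open Scope ring_scope.

Section Definitions.
Context {R : realType}.

(* The norm `|x| of 'rV[R]_d is the sup norm; this is the Euclidean one. *)
Definition enorm d (x : 'rV[R]_d) : R := Num.sqrt (\sum_i x 0 i ^+ 2).

Definition peval d (p : mpoly d R) (x : 'rV[R]_d) : R :=
  meval (fun i => x 0 i) p.

(* Polynomials of total degree at most q - 1: msize is 1 + total degree, and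
   is 0 for the zero polynomial, so that inPi 0 only contains 0. *)
Definition inPi d (q : nat) (p : mpoly d R) : Prop :=
  (msize p <= q)%N.

Definition basis_Pi d (s M : nat) (p : 'I_M -> mpoly d R) : Prop :=
  [/\ forall i, inPi s (p i),
      forall c : 'I_M -> R, \sum_i c i *: p i = 0 -> forall i, c i = 0 &
      forall r, inPi s r -> exists c : 'I_M -> R, r = \sum_i c i *: p i].

Definition partial d (i : 'I_d) (f : 'rV[R]_d -> R) : 'rV[R]_d -> R :=
  fun x => 'D_(delta_mx 0 i) f x.

Definition mpartial d (alpha : multinom d) (f : 'rV[R]_d -> R) :
    'rV[R]_d -> R :=
  foldr (fun i => iter (alpha i) (partial i)) f (enum 'I_d).

(* bmultinom d k.+1 is the finite type of multi-indices alpha with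
   |alpha| < k.+1. *)
Definition diffop d k (a : bmultinom d k.+1 -> 'rV[R]_d -> R)
    (f : 'rV[R]_d -> R) (x : 'rV[R]_d) : R :=
  \sum_(alpha : bmultinom d k.+1) a alpha x * mpartial alpha f x.

Definition truncpow (l : nat) (t : R) : R := Num.max (1 - t) 0 ^+ l.

Definition wint (phi : R -> R) (t : R) : R :=
  (\int[lebesgue_measure]_(tau in `[t, +oo[) (tau * phi tau))%R.

Definition wendland_phi (d n : nat) : R -> R :=
  iter n wint (truncpow (d./2 + n + 1)).

Definition wendland d n (x : 'rV[R]_d) : R := wendland_phi d n (enorm x).

Definition wendland_kernel d n (x y : 'rV[R]_d) : R := wendland n (x - y).

Definition segment d (z x : 'rV[R]_d) : set 'rV[R]_d :=
  [set z + t *: (x - z) | t in `[0, 1]].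

Definition star_set d N (z : 'rV[R]_d) (x : 'I_N -> 'rV[R]_d) :
    set 'rV[R]_d :=
  \bigcup_i segment z (x i).

Definition diameter d (A : set 'rV[R]_d) : R :=
  sup [set enorm (u.1 - u.2) | u in A `*` A].

Definition star_ball d N (z : 'rV[R]_d) (x : 'I_N -> 'rV[R]_d) :
    set 'rV[R]_d :=
  [set y | enorm y <= diameter (star_set z x)].

(* The element 0 makes the supremum 0, rather than -oo, when Omega has fewer
   than two points. *)
Definition holder0_seminorm d (gamma : R) (Omega : set 'rV[R]_d)
    (g : 'rV[R]_d -> R) : \bar R :=
  ereal_sup ([set 0%E] `|`
    [set (`|g u.1 - g u.2| / enorm (u.1 - u.2) `^ gamma)%:E
      | u in [set u | [/\ Omega u.1, Omega u.2 & u.1 != u.2]]]).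

(* For f defined and r times continuously differentiable on the whole space;
   its derivatives are restricted to Omega. *)
Definition holder_seminorm d (r : nat) (gamma : R) (Omega : set 'rV[R]_d)
    (f : 'rV[R]_d -> R) : \bar R :=
  \big[maxe/0%E]_(alpha : bmultinom d r.+1 | mdeg alpha == r)
    holder0_seminorm gamma Omega (mpartial alpha f).

Definition kernel_formula d k N M
    (a : bmultinom d k.+1 -> 'rV[R]_d -> R)
    (K : 'rV[R]_d -> 'rV[R]_d -> R) (p : 'I_M -> mpoly d R)
    (z : 'rV[R]_d) (x : 'I_N -> 'rV[R]_d)
    (w : 'I_N -> R) (v : 'I_M -> R) : Prop :=
  (forall i, \sum_j w j * K (x i) (x j) + \sum_j v j * peval (p j) (x i)
             = diffop a (K ^~ (x i)) z) /\
  (forall i, \sum_j w j * peval (p i) (x j) = diffop a (peval (p i)) z).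

(* Membership of f in the native space of K of order s, with semi-norm at most
   C, by duality with point evaluation functionals that annihilate the
   polynomials. For K conditionally positive definite of order s, the quadratic
   form under the square root is nonnegative. *)
Definition native_bound d (K : 'rV[R]_d -> 'rV[R]_d -> R) (s : nat)
    (f : 'rV[R]_d -> R) (C : R) : Prop :=
  0 <= C /\
  forall (m : nat) (y : 'I_m -> 'rV[R]_d) (c : 'I_m -> R),
    (forall p, inPi s p -> \sum_i c i * peval p (y i) = 0) ->
    `|\sum_i c i * f (y i)|
      <= C * Num.sqrt (\sum_i \sum_j c i * c j * K (y i) (y j)).

Definition native_space d (K : 'rV[R]_d -> 'rV[R]_d -> R) (s : nat) :
    set ('rV[R]_d -> R) :=
  [set f | exists C, native_bound K s f C].

Definition native_norm d (K : 'rV[R]_d -> 'rV[R]_d -> R) (s : nat)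
    (f : 'rV[R]_d -> R) : R :=
  inf [set C | native_bound K s f C].

Definition growth d k N (q : nat)
    (a : bmultinom d k.+1 -> 'rV[R]_d -> R)
    (z : 'rV[R]_d) (x : 'I_N -> 'rV[R]_d) (mu : R) : \bar R :=
  ereal_sup [set (diffop a (peval p) z)%:E
    | p in [set p | inPi q p /\
                    forall j, `|peval p (x j)| <= enorm (x j - z) `^ mu]].

Definition C_d_2n (d n : nat) : R :=
  2 * d%:R ^+ n / \prod_(1 <= i < n.+1) (2^-1 + i%:R) ^+ 2.

End Definitions.

(* Main.v *)
Require Import Defs.
From mathcomp Require Import all_boot all_order all_algebra.
From mathcomp Require Import all_classical all_reals all_analysis.
From mathcomp Require Import -(notations) mpoly.
From mathcomp Require Import ring lra zify.
Import Order.TTheory GRing.Theory Num.Theory.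
Import numFieldNormedType.Exports.
Local Open Scope classical_set_scope.
Local Open Scope ring_scope.

(* Let lambda_w be the functional [f |-> D f(z) - sum_j w_j f(x_j)] and Q the
   quadratic form of the kernel on finitely supported functionals. Smoothness
   of the kernel carries the duality bound |lambda f| <= ||f|| sqrt(Q lambda)
   over from point evaluations to functionals with derivatives: difference
   quotients are Cauchy because Q of their differences tends to 0. The weights
   w^* minimize Q up to a term that f does not see, so it suffices to bound
   Q lambda_w for one w exact on polynomials of order q; linear programming
   duality supplies such a w with sum_j |w_j| |x_j - z|^mu <= rho. For it,
   Q lambda_w = sum_ij w_i w_j R_ij, where R_ij is the remainder at (1, 1) of
   the Taylor expansion of order n in both variables of
   (s, t) |-> Phi(s u_i - t u_j), u_i = x_i - z. Its mixed derivative of order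
   (n, n) differs from its Taylor part by at most a multiple of
   min(s |u_i|, t |u_j|) <= sqrt(s |u_i| t |u_j|), and integrating sqrt s
   repeatedly produces the constant 1 / ((1/2 + 1) ... (1/2 + n)). *)

(** For [s > 0] the duality bound is available only for functionals that annihilate the polynomials
    of order [s], which the difference quotients replacing a derivative need not do. The polynomials
    are therefore removed one at a time: if [p0] does not vanish at [xi], subtracting a suitable
    multiple of the evaluation at [xi] makes any functional annihilate [p0]; transposed to the
    kernel, to the function and to the remaining polynomials, this projection leaves the same
    problem with one side condition fewer. In the constant, the factor 2 arises because a second
    difference is a difference of two first differences, each controlled by the Lipschitz constant;
    [d ^ n] is the price of comparing the sum norm with the Euclidean norm, [n] times in each
    variable at [sqrt d] each; and the product is squared because both variables are integrated. The
    right-hand side is a product of extended reals, where [0] times [+oo] is [0]. If the growth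
    function or the semi-norm of [f] vanishes, the error has to be shown to vanish whatever the
    Hölder semi-norm is. *)

Set Implicit Arguments.
Unset Strict Implicit.
Unset Printing Implicit Defensive.

(** * Functions with continuous iterated derivatives *)

Section Calculus.
Context {R : realType} {d : nat}.
Implicit Types (F G : 'rV[R]_d -> R) (x u : 'rV[R]_d).

(** The two difference quotients are the same function of the increment. This reduces directional
    derivatives to one real variable, where the mean value theorem and the chain rule apply. *)
Lemma is_derive_line F x u (s l : R) :
  is_derive s 1 (fun t : R => F (x + t *: u)) l <->
  is_derive (x + s *: u) u F l.
Proof.
have E : (fun h : R => h^-1 *: (((fun t : R => F (x + t *: u)) \o shift s)
           (h *: 1) - F (x + s *: u)))
       = (fun h : R => h^-1 *: ((F \o shift (x + s *: u)) (h *: u)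
           - F (x + s *: u))).
  apply/funext => h; rewrite /= [(h *: 1 : R)]mulr1; congr (_ *: (F _ - _)).
  by rewrite scalerDl addrCA.
split=> -[h1 h2]; split.
- by move: h1; rewrite /derivable E.
- by move: h2; rewrite /derive E.
- by rewrite /derivable E.
- by rewrite /derive E.
Qed.

(* Differentiability is only required along straight lines, with a
   derivative linear in the direction; this suffices for all the chain rules
   needed. *)
Fixpoint Cr (r : nat) F : Prop :=
  continuous F /\
  if r is r'.+1 then
    (forall x u, is_derive x u F (\sum_j u 0 j * partial j F x)) /\
    forall j, Cr r' (partial j F)
  else True.

Arguments Cr : simpl never.

Lemma partial_eq F (Fj : 'I_d -> 'rV[R]_d -> R) :
  (forall x u, is_derive x u F (\sum_j u 0 j * Fj j x)) ->
  forall j, partial j F = Fj j.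
Proof.
move=> h j; apply/funext => x; rewrite /partial.
rewrite (@derive_val _ _ _ _ _ _ _ (h x (delta_mx 0 j))).
rewrite (bigD1 j) //= mxE !eqxx mul1r big1 ?addr0 // => i ij.
by rewrite mxE (negbTE ij) andbF mul0r.
Qed.

Lemma CrS r F (Fj : 'I_d -> 'rV[R]_d -> R) : continuous F ->
  (forall x u, is_derive x u F (\sum_j u 0 j * Fj j x)) ->
  (forall j, Cr r (Fj j)) -> Cr r.+1 F.
Proof.
move=> cF dF cFj; split=> //; have E := partial_eq dF.
split=> [x u|j]; last by rewrite E.
by under eq_bigr do rewrite E.
Qed.

Lemma Cr_le r r' F : (r' <= r)%N -> Cr r F -> Cr r' F.
Proof.
elim: r' r F => [|r' IH] [|r] F //; first by move=> _ [].
by rewrite ltnS => rr [cF [dF h]]; split=> //; split=> // j; apply: IH (h j).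
Qed.

Lemma partial_derive j F x : Cr 1 F ->
  is_derive x (delta_mx 0 j) F (partial j F x).
Proof.
move=> [_ [dF _]]; have := dF x (delta_mx 0 j).
by move=> [h _]; apply: DeriveDef.
Qed.

Lemma Cr_cst r (c : R) : Cr r (cst c).
Proof.
elim: r c => [|r IH] c; first by split=> // x; exact: cst_continuous.
apply: (CrS (Fj := fun j => cst 0)) => //; first by move=> x; exact: cst_continuous.
by move=> x u; rewrite big1 => [|j _]; [exact: is_derive_cst|rewrite /cst mulr0].
Qed.

Lemma CrD r F G : Cr r F -> Cr r G -> Cr r (F \+ G).
Proof.
elim: r F G => [|r IH] F G.
  by move=> [cF _] [cG _]; split=> // x; apply: continuousD; [exact: cF|exact: cG].
move=> [cF [dF hF]] [cG [dG hG]].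
apply: (CrS (Fj := fun j => partial j F \+ partial j G)) => //.
- by move=> x; apply: continuousD; [exact: cF|exact: cG].
- move=> x u; under eq_bigr do rewrite mulrDr.
  by rewrite big_split /=; exact: is_deriveD.
- by move=> j; apply: IH; [exact: hF|exact: hG].
Qed.

Lemma CrZ r (c : R) F : Cr r F -> Cr r (fun x => c * F x).
Proof.
elim: r F => [|r IH] F.
  by move=> [cF _]; split=> // x; apply: continuousM; [exact: cst_continuous|exact: cF].
move=> [cF [dF hF]].
apply: (CrS (Fj := fun j x => c * partial j F x)) => //.
- by move=> x; apply: continuousM; [exact: cst_continuous|exact: cF].
- move=> x u; under eq_bigr do rewrite mulrCA.
  by rewrite -mulr_sumr; exact: (@is_deriveZ _ _ _ F c).
- by move=> j; apply: IH; exact: hF.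
Qed.



(** [h] may have either sign or vanish; the limits below use only that the intermediate point is no
    farther from 0 than [h]. *)
Lemma MVT0 (f df : R -> R) (h : R) : (forall s : R, is_derive s 1 f (df s)) ->
  exists2 c, `|c| <= `|h| & f h - f 0 = df c * h.
Proof.
move=> fdf.
have cf a b : {within `[a, b], continuous f}.
  apply: derivable_within_continuous => s _.
  by have [] := fdf s.
have [h0|h0] := leP 0 h.
  have [c] := MVT_segment h0 (fun s _ => fdf s) (cf _ _).
  rewrite in_itv /= subr0 => /andP[c0 ch] E.
  by exists c; rewrite // ger0_norm // ger0_norm.
have [c] := MVT_segment (ltW h0) (fun s _ => fdf s) (cf _ _).
rewrite in_itv /= sub0r => /andP[hc c0] E.
exists c; first by rewrite ler0_norm // ltr0_norm // lerN2.
by rewrite -opprB E mulrN opprK.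
Qed.

Lemma ltr_dist2 (a b c e : R) :
  `|a - b| < e / 2 -> `|a - c| < e / 2 -> `|b - c| < e.
Proof.
move=> ab ac; rewrite [ltRHS]splitr; apply: (le_lt_trans (ler_distD a _ _)).
by rewrite ltrD // distrC.
Qed.

Lemma eq_by_dist (b c : R) : (forall e : R, 0 < e -> `|b - c| < e) -> b = c.
Proof.
move=> h; apply/eqP; rewrite -subr_eq0 -normr_le0 leNgt; apply/negP => p.
by have := h _ p; rewrite ltxx.
Qed.

(** The second difference is the increment in [s] of [F s k - F s 0], so the mean value theorem
    applies in [s] and then in [t]. It serves both Schwarz's theorem and the mixed difference
    quotients of a kernel. *)
Lemma double_MVT (F Fs Fst : R -> R -> R) (h k : R) :
  (forall s t : R, is_derive s 1 (F^~ t) (Fs s t)) ->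
  (forall s t : R, is_derive t 1 (Fs s) (Fst s t)) ->
  exists s t, [/\ `|s| <= `|h|, `|t| <= `|k| &
    F h k - F h 0 - F 0 k + F 0 0 = h * k * Fst s t].
Proof.
move=> dF dFs.
have [s sh E] := MVT0 h (fun s => is_deriveB (dF s k) (dF s 0)).
have [t tk E'] := MVT0 k (dFs s).
exists s, t; split=> //.
rewrite (_ : _ - _ + _ = ((F^~ k) - (F^~ 0)) h - ((F^~ k) - (F^~ 0)) 0).
  by rewrite E E'; ring.
by rewrite !fctE; ring.
Qed.

Lemma continuous_planeP (G : 'rV[R]_d -> R) x u v : {for x, continuous G} ->
  forall e, 0 < e -> exists2 r, 0 < r & forall s t : R, `|s| < r -> `|t| < r ->
    `|G (x + s *: u + t *: v) - G x| < e.
Proof.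
move=> cG e e0.
have c2 : (fun p : R * R => x + p.1 *: u + p.2 *: v) @ nbhs (0, 0)
    --> (x + (0, 0 : R).1 *: u + (0 : R, 0).2 *: v).
  apply: cvgD; first (apply: cvgD; first exact: cvg_cst).
  - by apply: cvgZr_tmp; exact: cvg_fst.
  - by apply: cvgZr_tmp; exact: cvg_snd.
rewrite /= !scale0r !addr0 in c2.
have cGx : G @ x --> G x := cG.
have := cvg_comp _ _ c2 cGx => /cvgr_dist_lt /(_ e e0).
rewrite /= => /nbhs_ballP[r /= r0 H]; exists r => // s t sr tr.
rewrite distrC; apply: (H (s, t)); split; rewrite /= /ball /= sub0r normrN //.
Qed.

(** A second difference over a square of side [h] is [h * h] times either mixed derivative, each at
    its own point close to [x]; continuity of both makes them equal at [x]. *)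
Lemma Schwarz F i j : Cr 2 F -> partial i (partial j F) = partial j (partial i F).
Proof.
move=> [cF [dF h2]]; apply/funext => x.
set ei : 'rV[R]_d := delta_mx 0 i; set ej : 'rV[R]_d := delta_mx 0 j.
have D1 k l : Cr 1 (partial k F) /\ continuous (partial l (partial k F)).
  by split; [exact: h2|have [_ [_ h]] := h2 k; have [] := h l].
have key k (y : 'rV[R]_d) (G : 'rV[R]_d -> R) (s : R) : Cr 1 G ->
    is_derive s 1 (fun s : R => G (y + s *: delta_mx 0 k))
      (partial k G (y + s *: delta_mx 0 k)).
  by move=> cG; apply/is_derive_line; exact: partial_derive.
have key' k l (G : 'rV[R]_d -> R) (s t : R) : Cr 1 G ->
    is_derive s 1 (fun s : R => G (x + s *: delta_mx 0 k + t *: delta_mx 0 l))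
      (partial k G (x + s *: delta_mx 0 k + t *: delta_mx 0 l)).
  move=> cG; under eq_fun do rewrite addrAC.
  by rewrite addrAC; exact: key.
have C1 : Cr 1 F by split=> //; split=> // k; have [] := h2 k.
apply: eq_by_dist => e e0.
have e2 : 0 < e / 2 by rewrite divr_gt0.
have [r1 r10 H1] := continuous_planeP ei ej ((D1 j i).2 x) e2.
have [r2 r20 H2] := continuous_planeP ei ej ((D1 i j).2 x) e2.
pose h := Num.min r1 r2 / 2.
have m0 : 0 < Num.min r1 r2 by rewrite lt_min r10.
have hm : h < Num.min r1 r2 by rewrite /h; move: m0; set m := Num.min _ _; lra.
move: (hm); rewrite lt_min => /andP[hr1 hr2].
have h0 : 0 < h by rewrite divr_gt0.
have [s1 [t1 [s1h t1h E1]]] := @double_MVT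
  (fun s t => F (x + s *: ei + t *: ej))
  (fun s t => partial i F (x + s *: ei + t *: ej))
  (fun s t => partial j (partial i F) (x + s *: ei + t *: ej)) h h
  (fun s t => key' i j F s t C1) (fun s t => key j _ _ t (D1 i j).1).
have [t2 [s2 [t2h s2h E2]]] := @double_MVT
  (fun t s => F (x + s *: ei + t *: ej))
  (fun t s => partial j F (x + s *: ei + t *: ej))
  (fun t s => partial i (partial j F) (x + s *: ei + t *: ej)) h h
  (fun t s => key j (x + s *: ei) F t C1)
  (fun t s => key' i j _ s t (D1 j i).1).
have EE : partial j (partial i F) (x + s1 *: ei + t1 *: ej)
        = partial i (partial j F) (x + s2 *: ei + t2 *: ej).
  apply: (mulfI (lt0r_neq0 (mulr_gt0 h0 h0))).
  apply: (etrans (esym E1)); apply: etrans E2.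
  by congr (_ + _); exact: addrAC.
rewrite (gtr0_norm h0) in s1h t1h s2h t2h.
have A := H1 s2 t2 (le_lt_trans s2h hr1) (le_lt_trans t2h hr1).
have B := H2 s1 t1 (le_lt_trans s1h hr2) (le_lt_trans t1h hr2).
rewrite EE in B.
by have := ltr_dist2 A B.
Qed.

End Calculus.
Arguments Cr : simpl never.

(** * Iterated partial derivatives along words *)

Section Words.
Context {R : realType} {d : nat}.
Implicit Types (F G : 'rV[R]_d -> R) (x u : 'rV[R]_d) (w : seq 'I_d).

(** Words instead of multi-indices: differentiating once more is consing a letter, and inductions on
    the order become inductions on the word. The first letter is the outermost derivative. *)
Definition dword w F : 'rV[R]_d -> R := foldr (@partial R d) F w.

Definition mword (al : multinom d) : seq 'I_d :=
  flatten [seq nseq (al i) i | i <- enum 'I_d].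

Lemma mpartial_word al F : mpartial al F = dword (mword al) F.
Proof.
rewrite /mpartial /dword /mword; elim: (enum _) => //= i s ->.
by rewrite foldr_cat; elim: (al i) => //= k ->.
Qed.

Lemma count_mword al i : count_mem i (mword al) = al i.
Proof.
rewrite /mword count_flatten -map_comp sumnE big_map big_enum /=.
rewrite (bigD1 i) //= big1 ?addn0 => [|j ji]; first by rewrite count_nseq /= eqxx mul1n.
by rewrite count_nseq /= (negbTE ji) mul0n.
Qed.

Lemma size_mword al : size (mword al) = mdeg al.
Proof.
rewrite /mword size_flatten /shape -map_comp sumnE big_map big_enum /= mdegE.
by apply: eq_bigr => i _; rewrite /= size_nseq.
Qed.

Lemma dword_Cr w r F : Cr (size w + r) F -> Cr r (dword w F).
Proof.
elim: w r F => //= i w IH r F h.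
have [_ [_ h']] : Cr r.+1 (dword w F) by apply: IH; rewrite addnS -addSn.
exact: h'.
Qed.

Lemma dword_cat w w' F : dword (w ++ w') F = dword w (dword w' F).
Proof. exact: foldr_cat. Qed.

Lemma dword_swap w i F : Cr (size w).+1 F ->
  dword w (partial i F) = dword (i :: w) F.
Proof.
elim: w => //= j w IH h; rewrite IH; last exact: (Cr_le (leqnSn _) h).
by rewrite /= Schwarz //; apply: dword_Cr; rewrite addn2.
Qed.

Lemma dword_perm w w' F : Cr (size w) F -> perm_eq w w' ->
  dword w F = dword w' F.
Proof.
elim: w w' => [|i w IH] w' /= h pw.
  by move: pw; rewrite perm_sym => /perm_nilP ->.
have /path.splitPr iw' : i \in w' by rewrite -(perm_mem pw) mem_head.
case: iw' pw h => l r pw h.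
have pw' : perm_eq w (l ++ r).
  by rewrite -(perm_cons i); apply: (perm_trans pw); rewrite perm_catC /= perm_cons perm_catC.
have sw := perm_size pw'; rewrite size_cat in sw.
rewrite -[LHS]/(partial i (dword w F)) (IH _ (Cr_le (leqnSn _) h) pw') //.
rewrite !dword_cat; apply/esym/(@dword_swap l i (dword r F)).
by apply: dword_Cr; rewrite addnS addnC -sw.
Qed.

Lemma partialZ i (c : R) F : Cr 1 F ->
  partial i (fun x => c * F x) = fun x => c * partial i F x.
Proof.
move=> cF; apply/funext => x.
have h := @is_deriveZ _ _ _ F c _ _ _ (partial_derive i x cF).
exact: (@derive_val _ _ _ _ _ _ _ h).
Qed.

Lemma dwordZ w (c : R) F : Cr (size w) F ->
  dword w (fun x => c * F x) = fun x => c * dword w F x.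
Proof.
elim: w => //= i w IH cF; rewrite IH; last exact: (Cr_le (leqnSn _) cF).
by rewrite partialZ //; apply: dword_Cr; rewrite addn1.
Qed.

Lemma dword_shift w F c : dword w (fun x => F (x - c)) = fun x => dword w F (x - c).
Proof.
elim: w => //= i w ->; apply/funext => x; rewrite /partial /derive.
set G := dword w F; rewrite (_ : (fun h => _) = (fun h : R =>
  h^-1 *: ((G \o shift (x - c)) (h *: delta_mx 0 i) - G (x - c)))) //.
by apply/funext => h /=; rewrite addrA.
Qed.

Lemma dword_even w F : Cr (size w) F -> (forall x, F (- x) = F x) ->
  forall x, dword w F (- x) = (-1) ^+ size w * dword w F x.
Proof.
elim: w => [|i w IH] /= cF eF x; first by rewrite mul1r.
have c1 : Cr 1 (dword w F) by apply: dword_Cr; rewrite addn1.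
have E : (fun y => dword w F (- y)) = (fun y => (-1) ^+ size w * dword w F y).
  by apply/funext => y; apply: IH => //; exact: (Cr_le (leqnSn _) cF).
have D y v : is_derive y v (fun y => dword w F (- y))
    (\sum_j v 0 j * - partial j (dword w F) (- y)).
  have [_ [h _]] := c1.
  have /is_derive_line H : is_derive (- y + (0 : R) *: - v) (- v) (dword w F)
     (\sum_j v 0 j * - partial j (dword w F) (- y)).
    rewrite scale0r addr0.
    have := h (- y) (- v).
    by under eq_bigr do rewrite mxE mulNr -mulrN.
  have : is_derive (y + (0 : R) *: v) v (fun y => dword w F (- y))
    (\sum_j v 0 j * - partial j (dword w F) (- y)).
    apply/is_derive_line; move: H.
    by under eq_fun do rewrite scalerN -opprD.
  by rewrite scale0r addr0.
have := partial_eq D i; rewrite E partialZ // => /(congr1 (fun f => f x)) /=.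
rewrite exprS -mulrA => ->.
by rewrite mulrN mulN1r opprK.
Qed.

End Words.

(** * Polynomial functions and their derivatives *)

Section Polynomials.
Context {R : realType} {d : nat}.
Implicit Types (p q : mpoly d R) (x u : 'rV[R]_d).

Lemma pevalD p q : peval (p + q) = peval p \+ peval q.
Proof. by apply/funext => x; rewrite /peval mevalD. Qed.

Lemma pevalZ c p x : peval (c *: p) x = c * peval p x.
Proof. by rewrite /peval mevalZ. Qed.

Lemma pevalM p q x : peval (p * q) x = peval p x * peval q x.
Proof. by rewrite /peval mevalM. Qed.

Lemma peval_sum (I : Type) (r : seq I) (P : pred I) (Fp : I -> mpoly d R) x :
  peval (\sum_(i <- r | P i) Fp i) x = \sum_(i <- r | P i) peval (Fp i) x.
Proof. by rewrite /peval raddf_sum. Qed.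

Lemma pevalXi i x : peval (mpolyX R (mnm1 i)) x = x 0 i.
Proof. by rewrite /peval mevalXU. Qed.

Lemma peval_derive p x u :
  is_derive x u (peval p) (\sum_j u 0 j * peval (mderiv j p) x).
Proof.
pose P p := forall x u : 'rV[R]_d,
  is_derive x u (peval p) (\sum_j u 0 j * peval (mderiv j p) x).
have PD q r : P q -> P r -> P (q + r).
  move=> hq hr {}x {}u; rewrite pevalD.
  under eq_bigr do rewrite mderivD pevalD mulrDr.
  by rewrite big_split; exact: is_deriveD.
have PZ c q : P q -> P (c *: q).
  move=> hq {}x {}u.
  rewrite (_ : peval _ = c *: peval q); last by apply/funext => y; rewrite pevalZ.
  under eq_bigr do rewrite mderivZ pevalZ mulrCA.
  by rewrite -mulr_sumr; exact: is_deriveZ.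
have PM q r : P q -> P r -> P (q * r).
  move=> hq hr {}x {}u.
  rewrite (_ : peval _ = peval q * peval r); last by apply/funext => y; rewrite pevalM.
  apply: (is_derive_eq (is_deriveM (hq x u) (hr x u))).
  rewrite /GRing.scale /= !mulr_sumr -big_split /=; apply: eq_bigr => j _.
  by rewrite mderivM pevalD /= !pevalM; ring.
have P0 c : P (mpolyC d c).
  move=> {}x {}u.
  rewrite (_ : peval _ = cst c); last by apply/funext => y; rewrite /peval mevalC.
  rewrite big1 => [|j _]; first exact: is_derive_cst.
  by rewrite mderivC /peval meval0 mulr0.
have PX i : P (mpolyX R (mnm1 i)).
  move=> {}x {}u.
  rewrite (bigD1 i) //= big1 ?addr0 => [|j ji]; last first.
    by rewrite mderivX mnm1E eq_sym (negbTE ji) scale0r /peval meval0 mulr0.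
  rewrite mderivX mnm1E eqxx scale1r (_ : peval _ = fun y => y 0 i); last first.
    by apply/funext => y; rewrite pevalXi.
  have -> : mnm_sub (mnm1 i) (mnm1 i) = mnm0 by rewrite -{1}[mnm1 i]add0m addmK.
  rewrite /peval mpolyX0 meval1 mulr1.
  suff : is_derive (x + (0 : R) *: u) u (fun y => y 0 i) (u 0 i).
    by rewrite scale0r addr0.
  apply/is_derive_line; under eq_fun do rewrite !mxE.
  under eq_fun do rewrite mulrC.
  have := is_deriveD (is_derive_cst (x 0 i) (0 : R) (1 : R))
    (@is_deriveZ _ _ _ id (u 0 i) (0 : R) 1 1 (is_derive_id _ _)).
  by rewrite add0r /GRing.scale /= mulr1.
suff : P p by apply.
elim/mpolyind: p => [|c m p _ _ hp]; first by rewrite -mpolyC0; exact: P0.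
apply: (PD _ _ _ hp); apply: PZ; rewrite mpolyXE_id.
elim/big_rec: _ => [|i q _ hq]; first by rewrite -mpolyC1; exact: P0.
apply: (PM _ _ _ hq); elim: (m i) => [|k IH]; first by rewrite expr0 -mpolyC1; exact: P0.
by rewrite exprS; exact: PM.
Qed.

Lemma peval_continuous p : continuous (peval p).
Proof.
move=> x; pose C p := peval p @ x --> peval p x.
have CM q r : C q -> C r -> C (q * r).
  move=> hq hr; rewrite /C pevalM (_ : peval (q * r) = (fun y => peval q y * peval r y)).
    exact: (cvgM hq hr).
  by apply/funext => y; rewrite pevalM.
have C0 c : C (mpolyC d c).
  rewrite /C (_ : peval _ = cst c); first exact: cst_continuous.
  by apply/funext => y; rewrite /peval mevalC.
have CX i : C (mpolyX R (mnm1 i)).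
  rewrite /C pevalXi (_ : peval _ = fun y => y 0 i); first exact: coord_continuous.
  by apply/funext => y; rewrite pevalXi.
suff : C p by [].
elim/mpolyind: p => [|c m p _ _ hp]; first by rewrite -mpolyC0; exact: C0.
rewrite /C pevalD; apply: cvgD hp; rewrite -mul_mpolyC; apply: (CM) => //.
rewrite mpolyXE_id.
elim/big_rec: _ => [|i q _ hq]; first by rewrite -mpolyC1; exact: C0.
apply: (CM) => //; elim: (m i) => [|k IH]; first by rewrite expr0 -mpolyC1; exact: C0.
by rewrite exprS; exact: (CM).
Qed.

Lemma Cr_peval r p : Cr r (peval p).
Proof.
elim: r p => [|r IH] p; first by split=> //; exact: peval_continuous.
apply: (CrS (Fj := fun j => peval (mderiv j p))) => //.
- exact: peval_continuous.
- by move=> x u; exact: peval_derive.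
Qed.

Lemma dword_peval w p : dword w (peval p) = peval (foldr (@mderiv d R) p w).
Proof. elim: w => //= i w ->; set q := foldr _ _ _.
by apply: (@partial_eq _ _ _ (fun j => peval (mderiv j q))) => x u; exact: peval_derive. Qed.

End Polynomials.

(** * One-dimensional profiles *)

Section Profile.
Context {R : realType}.
Implicit Types (phi : R -> R) (t : R).

Lemma cvg_exprn (T : Type) (F : set_system T) {FF : Filter F} (f : T -> R) (a : R) n :
  f x @[x --> F] --> a -> f x ^+ n @[x --> F] --> a ^+ n.
Proof. by move=> fa; exact: (cvg_comp _ _ fa (@exprn_continuous R n a)). Qed.

Lemma is_derive_cvg (V : normedModType R) (F : V -> R) (x u : V) (l : R) :
  h^-1 * (F (x + h *: u) - F x) @[h --> 0^'] --> l <-> is_derive x u F l.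
Proof.
have E : (fun h : R => h^-1 * (F (x + h *: u) - F x))
   = (fun h : R => h^-1 *: ((F \o shift x) (h *: u) - F x)).
  by apply/funext => h /=; rewrite (addrC x).
rewrite E; split=> [C|[d1 <-] //].
by apply: DeriveDef; [apply/cvg_ex; exists l|exact: cvg_lim].
Qed.

Lemma is_derive_bound (V : normedModType R) (F : V -> R) (x u : V) (l : R)
    (e : R -> R) : e h @[h --> 0] --> 0 ->
  (forall h, h != 0 -> `|h^-1 * (F (x + h *: u) - F x) - l| <= e h) ->
  is_derive x u F l.
Proof.
move=> e0 H; apply/is_derive_cvg/cvgrPdist_le => /= r r0.
have /cvgr0Pnorm_le /(_ r r0) He : e h @[h --> 0^'] --> 0.
  by apply: cvg_trans e0; apply: cvg_app; exact: nbhs_dnbhs.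
near=> h.
have h0 : h != 0 by near: h; exact: nbhs_dnbhs_neq.
rewrite distrC; apply: (le_trans (H h h0)).
by apply: (le_trans (ler_norm _)); near: h.
Unshelve. all: by end_near. Qed.

Lemma is_deriveD_fun (V : normedModType R) (f1 f2 : V -> R) x v df1 df2 :
  is_derive x v f1 df1 -> is_derive x v f2 df2 ->
  is_derive x v (fun y => f1 y + f2 y) (df1 + df2).
Proof. exact: is_deriveD. Qed.

Lemma is_deriveZ_fun (V : normedModType R) (c : R) (f1 : V -> R) x v df1 :
  is_derive x v f1 df1 -> is_derive x v (fun y => c * f1 y) (c * df1).
Proof. by move=> h; exact: (is_deriveZ c h). Qed.

Lemma is_derive_continuous phi (dphi : R -> R) :
  (forall t, is_derive t 1 phi (dphi t)) -> continuous phi.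
Proof.
move=> h t; apply: differentiable_continuous.
by apply/derivable1_diffP; have [] := h t.
Qed.

Lemma continuousZ_for (c : R) (f : R -> R) (r : R) :
  {for r, continuous f} -> {for r, continuous (fun s => c * f s)}.
Proof. by move=> cf; apply: cvgM cf; exact: cvg_cst. Qed.

(** Since [phi] vanishes beyond 1, the half-line can be replaced by a compact interval, where
    continuity gives integrability and the fundamental theorem of calculus applies. *)
Lemma wint_bounded phi t b : (forall s, 1 <= s -> phi s = 0) -> 1 <= b ->
  wint phi t = \int[lebesgue_measure]_(s in `[t, b]) (s * phi s).
Proof.
move=> phi0 b1; rewrite /wint Rintegral_mkcond [RHS]Rintegral_mkcond.
congr (Rintegral _ _ _); apply/funext => s; rewrite !patchE.
case: ifPn => [|/negP h].
  rewrite inE /= in_itv /= andbT => ts.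
  case: ifPn => // /negP h; rewrite phi0 ?mulr0 //.
  have [sb|/ltW bs] := leP s b; last exact: le_trans bs.
  by exfalso; apply: h; rewrite inE /= in_itv /= ts.
case: ifPn => // /[!inE] /=; rewrite in_itv /= => /andP[ts _].
by exfalso; apply: h; rewrite inE /= in_itv /= ts.
Qed.

Lemma wint_derive phi t : continuous phi -> (forall s, 1 <= s -> phi s = 0) ->
  is_derive t 1 (wint phi) (- (t * phi t)).
Proof.
move=> cphi phi0; pose h s := s * phi s.
have ch : continuous h by move=> s; apply: cvgM; [exact: cvg_id|exact: cphi].
pose b := Num.max t 1 + 1; pose a := t - 1.
have tb : t < b by rewrite /b ltr_pwDr // le_max lexx.
have b1 : 1 <= b by rewrite /b -[leLHS]add0r lerD // le_max ler01 orbT.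
have at_ : a < t by rewrite /a ltrBlDr ltrDl.
have ih c e : lebesgue_measure.-integrable `[c, e] (EFin \o h).
  apply: continuous_compact_integrable; first exact: segment_compact.
  exact: continuous_subspaceT.
have [dF F'] := @continuous_FTC1 R h (BLeft a) t b tb (ih a b) at_ (ch t).
pose F x := \int[lebesgue_measure]_(s in `[a, x]) h s.
have dFt : is_derive t 1 F (h t).
  by apply: DeriveDef; [exact: dF|rewrite -derive1E; exact: F'].
(* The variable end point is the lower one: near [t] the integral is the constant [F b] minus [F x],
   whence the sign of the derivative. *)
have E : \forall x \near t, (cst (F b) - F) x = wint phi x.
  near=> x; have ax : a < x by near: x; exact: lt_nbhsr.
  have xb : x < b by near: x; exact: lt_nbhsl.
  rewrite (wint_bounded _ phi0 b1) -/h !fctE /F.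
  rewrite (@Rintegral_itvB R h (BLeft a) (BRight b) x (ih a b)).
  - rewrite Rintegral_itv_obnd_cbnd //.
    apply: (integrableS _ _ _ (ih x b)) => //.
    exact: subset_itv_oc_cc.
  - by rewrite bnd_simp ltW.
  - by rewrite bnd_simp ltW.
apply: (near_eq_is_derive E).
by apply: (is_derive_eq (is_deriveB (is_derive_cst (F b) t 1) dFt)); rewrite sub0r.
Unshelve. all: by end_near. Qed.

Lemma wint_eq0 phi t : (forall s, 1 <= s -> phi s = 0) -> 1 <= t ->
  wint phi t = 0.
Proof.
move=> phi0 t1; rewrite (wint_bounded _ phi0 t1) set_itv1.
exact: Rintegral_set1.
Qed.

Lemma truncpow_eq0 l t : (0 < l)%N -> 1 <= t -> truncpow l t = 0.
Proof.
by case: l => // l _ t1; rewrite /truncpow max_r ?subr_le0 // expr0n.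
Qed.

Lemma truncpow_continuous l : continuous (truncpow l : R -> R).
Proof.
move=> t; rewrite /truncpow; apply: cvg_exprn.
apply: (@continuous_max R _ (fun t => 1 - t) (fun=> 0)); last exact: cvg_cst.
by apply: cvgB; [exact: cvg_cst|exact: cvg_id].
Qed.

Lemma truncpow_derive l t :
  is_derive t 1 (truncpow l.+2 : R -> R) (- (l.+2%:R * truncpow l.+1 t)).
Proof.
have [t1|t1|->] := ltgtP t 1.
- have E : \forall s \near t, ((cst 1 - id : R -> R) ^+ l.+2) s = truncpow l.+2 s.
    near=> s; rewrite /truncpow max_l ?fctE // subr_ge0.
    by apply: ltW; near: s; exact: lt_nbhsl.
  apply: (near_eq_is_derive E).
  have d1 := is_deriveB (is_derive_cst (1 : R) t 1) (is_derive_id t (1 : R)).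
  apply: (is_derive_eq (is_deriveX l.+2 d1)).
  have M : Num.max (1 - t) 0 = 1 - t by rewrite max_l // subr_ge0; exact: ltW.
  rewrite /= !fctE /truncpow M sub0r.
  by rewrite /GRing.scale /= mulrN1.
- have E : \forall s \near t, cst 0 s = truncpow l.+2 s.
    near=> s; rewrite truncpow_eq0 //.
    by apply: ltW; near: s; exact: lt_nbhsr.
  apply: (near_eq_is_derive E).
  by rewrite truncpow_eq0 ?ltW // mulr0 oppr0; exact: is_derive_cst.
(* At the kink the claimed derivative is 0, and the quotient is at most [|h|] to the positive power
   [l.+1]. *)
- apply: (@is_derive_bound R _ _ _ _ (fun h => `|h| ^+ l.+1)).
    have : `|h| ^+ l.+1 @[h --> (0 : R)] --> `|0 : R| ^+ l.+1.
      by apply: cvg_exprn; apply: cvg_norm; exact: cvg_id.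
    by rewrite normr0 expr0n.
  move=> h h0; rewrite [h *: 1]mulr1 [truncpow _ 1]truncpow_eq0 //.
  rewrite [truncpow l.+1 1]truncpow_eq0 // mulr0 !(oppr0, addr0) /truncpow.
  rewrite normrM normfV ler_pdivrMl ?normr_gt0 // -exprS normrX.
  rewrite lerXn2r ?nnegrE // opprD addNKr.
  by rewrite ger0_norm ?le_max ?lexx ?orbT // ge_max normr_ge0 -normrN ler_norm.
Unshelve. all: by end_near. Qed.

End Profile.

(** * The Euclidean norm *)

Section Enorm.
Context {R : realType} {d : nat}.
Implicit Types (x y u : 'rV[R]_d) (w : seq 'I_d).

Lemma enorm_ge0 x : 0 <= enorm x.
Proof. exact: sqrtr_ge0. Qed.

Lemma sqr_enorm x : enorm x ^+ 2 = \sum_i x 0 i ^+ 2.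
Proof. by rewrite sqr_sqrtr //; apply: sumr_ge0 => i _; exact: sqr_ge0. Qed.

Lemma enormZ s x : enorm (s *: x) = `|s| * enorm x.
Proof.
rewrite /enorm; under eq_bigr do rewrite mxE exprMn.
by rewrite -mulr_sumr sqrtrM ?sqr_ge0 // sqrtr_sqr.
Qed.

Lemma enorm0 : enorm (0 : 'rV[R]_d) = 0.
Proof. by rewrite -[X in enorm X](scale0r (0 : 'rV[R]_d)) enormZ normr0 mul0r. Qed.

Lemma enormN x : enorm (- x) = enorm x.
Proof. by rewrite -scaleN1r enormZ normrN1 mul1r. Qed.

Lemma le_enorm x i : `|x 0 i| <= enorm x.
Proof.
rewrite -sqrtr_sqr /enorm ler_wsqrtr // (bigD1 i) //= lerDl.
by apply: sumr_ge0 => j _; exact: sqr_ge0.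
Qed.

Lemma enorm_gt0 x : (0 < enorm x) = (x != 0).
Proof.
rewrite lt_neqAle enorm_ge0 andbT eq_sym; congr (~~ _); apply/eqP/eqP => [x0|->].
  apply/rowP => i; rewrite mxE; apply/normr0_eq0/eqP.
  by rewrite eq_le normr_ge0 andbT -x0 le_enorm.
exact: enorm0.
Qed.

Definition pword w : mpoly d R := \prod_(i <- w) mpolyX R (mnm1 i).

Definition xword w x : R := \prod_(i <- w) x 0 i.

Lemma peval_pword w : peval (pword w) = xword w.
Proof.
apply/funext => x; rewrite /pword /xword; elim: w => [|i w IH].
  by rewrite !big_nil /peval meval1.
by rewrite !big_cons pevalM IH pevalXi.
Qed.

Lemma mderiv_pword j w :
  mderiv j (pword w) = (count_mem j w)%:R *: pword (rem j w).
Proof.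
rewrite /pword; elim: w => [|i w IH].
  by rewrite !big_nil /= scale0r -mpolyC1 mderivC.
rewrite !big_cons mderivM IH mderivX mnm1E /=.
have [->|ij] := eqVneq i j; last first.
  by rewrite scale0r mul0r !add0r big_cons scalerAr.
have -> : mnm_sub (mnm1 j) (mnm1 j) = mnm0 by rewrite -{1}[mnm1 j]add0m addmK.
rewrite scale1r mpolyX0 mul1r natrD scalerDl scale1r; congr (_ + _).
have [jw|jw] := boolP (j \in w).
  by rewrite (perm_big _ (perm_to_rem jw)) /= big_cons scalerAr.
by rewrite (count_memPn jw) !scale0r mulr0.
Qed.

Lemma xword_derive w x u :
  is_derive x u (xword w)
    (\sum_j u 0 j * ((count_mem j w)%:R * xword (rem j w) x)).
Proof.
have := peval_derive (pword w) x u; rewrite peval_pword.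
by under eq_bigr do rewrite mderiv_pword pevalZ peval_pword.
Qed.

Lemma xword_continuous w : continuous (xword w).
Proof. by rewrite -peval_pword; exact: peval_continuous. Qed.

Lemma xword_le w x : `|xword w x| <= enorm x ^+ size w.
Proof.
rewrite /xword; elim: w => [|i w IH]; first by rewrite big_nil normr1.
by rewrite big_cons normrM exprS ler_pM ?le_enorm.
Qed.

Definition sumsq : mpoly d R := \sum_i mpolyX R (mnm1 i) ^+ 2.

Lemma peval_sumsq x : peval sumsq x = enorm x ^+ 2.
Proof.
rewrite sqr_enorm /sumsq peval_sum; apply: eq_bigr => i _.
by rewrite expr2 pevalM pevalXi.
Qed.

Lemma enormE x : enorm x = Num.sqrt (peval sumsq x).
Proof. by rewrite peval_sumsq sqrtr_sqr ger0_norm ?enorm_ge0. Qed.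

Lemma enorm_continuous : continuous (@enorm R d).
Proof.
move=> x; rewrite (_ : @enorm R d = Num.sqrt \o peval sumsq); last first.
  by apply/funext => y; rewrite /= enormE.
apply: continuous_comp; first exact: peval_continuous.
exact: sqrt_continuous.
Qed.

Lemma enorm_derive x u : x != 0 ->
  is_derive x u (@enorm R d) ((\sum_j u 0 j * x 0 j) / enorm x).
Proof.
rewrite -enorm_gt0 => x0.
suff : is_derive (x + (0 : R) *: u) u (@enorm R d) ((\sum_j u 0 j * x 0 j) / enorm x).
  by rewrite scale0r addr0.
apply/is_derive_line.
rewrite (_ : (fun _ => _) = Num.sqrt \o (fun t : R => peval sumsq (x + t *: u))); last first.
  by apply/funext => t; rewrite /= enormE.
have D : is_derive (0 : R) 1 (fun t : R => peval sumsq (x + t *: u))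
    (\sum_j u 0 j * (x 0 j *+ 2)).
  apply/is_derive_line; rewrite scale0r addr0.
  have := peval_derive sumsq x u; congr (is_derive _ _ _ _).
  apply: eq_bigr => j _; congr (_ * _); rewrite /sumsq raddf_sum peval_sum /=.
  rewrite (bigD1 j) //= big1 ?addr0 => [|i ij]; last first.
    rewrite expr2 mderivM mderivX mnm1E (negbTE ij) scale0r mul0r mulr0 addr0.
    by rewrite /peval meval0.
  rewrite expr2 mderivM mderivX mnm1E eqxx scale1r.
  have -> : mnm_sub (mnm1 j) (mnm1 j) = mnm0 by rewrite -{1}[mnm1 j]add0m addmK.
  by rewrite mpolyX0 mul1r mulr1 pevalD /= pevalXi mulr2n.
have D2 : is_derive (peval sumsq (x + (0 : R) *: u)) 1 Num.sqrt (2 * enorm x)^-1.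
  rewrite scale0r addr0 enormE; apply: is_derive1_sqrt.
  by rewrite peval_sumsq exprn_gt0.
apply: (is_derive_eq (is_derive1_comp D2 D)).
under [in LHS]eq_bigr do rewrite mulrnAr.
rewrite sumrMnl -[X in _ * X]mulr_natr invfM; field.
by rewrite (gt_eqF x0).
Qed.

End Enorm.

(** * Smoothness of radial functions *)

Section Radial.
Context {R : realType} {d : nat} (n : nat) (g : nat -> R -> R).
Implicit Types (x y u : 'rV[R]_d) (w : seq 'I_d).

(** [g m] is the [m]-th iterate of [f |-> f' / r] on a radial profile, so that the gradient of
    [g m (enorm x)] is [g m.+1 (enorm x)] times [x]. Up to [m = n] it is continuous at 0; beyond, it
    may grow like the power [1 - 2 * (m - n)] of [r], and its value at 0 is set to 0. *)
Hypothesis g_continuous : forall m (r : R), (m <= 2 * n)%N -> 0 < r ->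
  {for r, continuous (g m)}.
Hypothesis g_derive : forall m (r : R), (m < 2 * n)%N -> 0 < r ->
  is_derive r 1 (g m) (r * g m.+1 r).
Hypothesis g_continuous0 : forall m, (m <= n)%N -> {for (0 : R), continuous (g m)}.
Hypothesis g_derive0 : forall m, (m < n)%N -> is_derive (0 : R) 1 (g m) 0.
Hypothesis g_sing0 : forall m, (n < m)%N -> g m 0 = 0.
Hypothesis g_sing : forall m, (n < m <= 2 * n)%N -> exists2 C : R, 0 <= C &
  forall r, 0 < r -> `|r ^+ (2 * (m - n)).-1 * g m r| <= C.

(** These terms are closed under differentiation up to linear combinations: a derivative falls
    either on the monomial or on the profile, where it produces another coordinate. *)
Definition radial w m x : R := xword w x * g m (enorm x).

(** The second hypothesis says that the degree of the monomial exceeds the order [2 * (m - n) - 1]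
    of the singularity by at least one. *)
Lemma radial_sing w m : (n < m <= 2 * n)%N -> (2 * m <= 2 * n + size w)%N ->
  exists2 C : R, 0 <= C &
    forall x, `|radial w m x| <= C * enorm x ^+ (2 * n + size w - 2 * m).+1.
Proof.
move=> nm mw; have [C C0 hC] := g_sing nm; exists C => // x.
have [->|x0] := eqVneq x 0.
  by rewrite /radial enorm0 g_sing0 ?mulr0 ?normr0 ?expr0n ?mulr0 //; case/andP: nm.
have r0 : 0 < enorm x by rewrite enorm_gt0.
rewrite /radial normrM; apply: (le_trans (ler_wpM2r (normr_ge0 _) (xword_le w x))).
set e := (2 * n + size w - 2 * m)%N.
have -> : size w = (e.+1 + (2 * (m - n)).-1)%N by rewrite /e; case/andP: nm; lia.
rewrite exprD -mulrA mulrC ler_wpM2r ?exprn_ge0 ?enorm_ge0 //.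
have := hC _ r0; rewrite normrM ger0_norm ?exprn_ge0 ?enorm_ge0 //.
Qed.

Lemma radial_continuous w m : (m <= 2 * n)%N -> (2 * m <= 2 * n + size w)%N ->
  continuous (radial w m).
Proof.
move=> mn mw x.
have key : {for enorm x, continuous (g m)} -> {for x, continuous (radial w m)}.
  move=> cg; have cge : {for x, continuous (g m \o @enorm R d)}.
    exact: (continuous_comp (@enorm_continuous R d x)).
  exact: (cvgM (@xword_continuous R d w x) cge).
have [x0|x0] := eqVneq x 0; last by apply: key; apply: g_continuous; rewrite ?enorm_gt0.
have [m_n|n_m] := leqP m n.
  by apply: key; rewrite x0 enorm0; exact: g_continuous0.
have [|C C0 hC] := @radial_sing w m _ mw; first by rewrite n_m.
have E : radial w m x = 0 by rewrite x0 /radial enorm0 g_sing0 // mulr0.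
suff H : radial w m y @[y --> x] --> (0 : R) by rewrite /continuous_at E.
suff H : `|radial w m y| @[y --> x] --> (0 : R) by exact: (norm_cvg0 H).
have ce : C * enorm y ^+ (2 * n + size w - 2 * m).+1 @[y --> x] --> (0 : R).
  have ce : enorm y @[y --> x] --> (0 : R).
    by have := @enorm_continuous R d x; rewrite /continuous_at x0 enorm0.
  have := cvgM (cvg_cst C) (cvg_exprn (n := (2 * n + size w - 2 * m).+1) ce).
  by rewrite expr0n /= mulr0; apply.
apply: (squeeze_cvgr _ (cvg_cst 0) ce); near=> y.
by rewrite normr_ge0 hC.
Unshelve. all: by end_near. Qed.

Lemma radial_derive w m x u : (m < 2 * n)%N -> (2 * m < 2 * n + size w)%N ->
  is_derive x u (radial w m) (\sum_j u 0 j *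
    ((count_mem j w)%:R * radial (rem j w) m x + radial (j :: w) m.+1 x)).
Proof.
move=> mn mw.
have [x0|x0] := eqVneq x 0; last first.
  have r0 : 0 < enorm x by rewrite enorm_gt0.
  have dg : is_derive x u (g m \o @enorm R d)
      (enorm x * g m.+1 (enorm x) * ((\sum_j u 0 j * x 0 j) / enorm x)).
    suff : is_derive (x + (0 : R) *: u) u (g m \o @enorm R d)
      (enorm x * g m.+1 (enorm x) * ((\sum_j u 0 j * x 0 j) / enorm x)).
      by rewrite scale0r addr0.
    apply/is_derive_line.
    apply: (@is_derive1_comp _ (g m) (fun t : R => enorm (x + t *: u))).
      by rewrite scale0r addr0; exact: g_derive.
    by apply/is_derive_line; rewrite scale0r addr0; exact: enorm_derive.
  have D := is_deriveM (xword_derive w x u) dg.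
  rewrite (_ : radial w m = xword w * (g m \o @enorm R d)) //.
  apply: (is_derive_eq D); rewrite /GRing.scale /=.
  transitivity (\sum_j u 0 j * (xword w x * (g m.+1 (enorm x) * x 0 j) +
    g m (enorm x) * ((count_mem j w)%:R * xword (rem j w) x))).
    under [RHS]eq_bigr do rewrite mulrDr.
    rewrite big_split /=; congr (_ + _).
      rewrite !mulr_suml !mulr_sumr; apply: eq_bigr => j _; field.
      by rewrite gt_eqF.
    by rewrite mulr_sumr; apply: eq_bigr => j _; ring.
  apply: eq_bigr => j _; rewrite /radial /xword big_cons; ring.
have z0 j : radial (j :: w) m.+1 x = 0.
  by rewrite x0 /radial /xword big_cons mxE !mul0r.
under eq_bigr do rewrite z0 addr0.
(* At 0 with [m > n] all terms of the claimed derivative vanish, and [radial_sing] bounds the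
   quotient by a positive power of [|h|]. *)
have [m_n|n_m] := leqP m n; last first.
  rewrite big1 => [|j _]; last by rewrite /radial x0 enorm0 g_sing0 // !mulr0.
  have [||C C0 hC] := @radial_sing w m; [by rewrite n_m ltnW|by rewrite ltnW|].
  set e := (2 * n + size w - 2 * m)%N in hC.
  have e0 : (0 < e)%N by rewrite /e subn_gt0.
  apply: (@is_derive_bound _ _ _ _ _ _ (fun h => C * enorm u ^+ e.+1 * `|h| ^+ e)).
    have H : `|h| ^+ e @[h --> (0 : R)] --> `|0 : R| ^+ e.
      by apply: cvg_exprn; apply: cvg_norm; exact: cvg_id.
    have := cvgM (cvg_cst (C * enorm u ^+ e.+1)) H.
    by rewrite normr0 expr0n eqn0Ngt e0 /= mulr0; apply.
  move=> h h0; rewrite x0 add0r subr0.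
  rewrite [radial w m 0]/radial enorm0 g_sing0 // mulr0 subr0.
  rewrite normrM normfV ler_pdivrMl ?normr_gt0 //.
  apply: (le_trans (hC _)); rewrite enormZ exprMn !exprS.
  by rewrite le_eqVlt; apply/orP; left; apply/eqP; ring.
(* A nonempty monomial vanishes at 0, so the quotient is that of the monomial times [g m], and
   continuity of [g m] suffices. *)
have [|w0] := ltnP 0 (size w).
  move=> w0; apply/is_derive_cvg.
  have xw0 : xword w x = 0.
    by case: (w) w0 => // i w' _; rewrite x0 /xword big_cons mxE mul0r.
  have H1 : h^-1 * (xword w (x + h *: u) - xword w x) @[h --> 0^'] -->
      \sum_j u 0 j * ((count_mem j w)%:R * xword (rem j w) x).
    by apply/is_derive_cvg; exact: xword_derive.
  have H2 : g m (enorm (x + h *: u)) @[h --> 0^'] --> g m (enorm x).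
    have c0 : {for enorm x, continuous (g m)}.
      by rewrite x0 enorm0; exact: g_continuous0.
    have cl : {for x, continuous (g m \o @enorm R d)}.
      exact: (continuous_comp (@enorm_continuous R d x)).
    have l0 : x + h *: u @[h --> 0^'] --> x.
      have l0 : x + h *: u @[h --> (0 : R)] --> x + (0 : R) *: u.
        by apply: cvgD; [exact: cvg_cst|apply: cvgZr_tmp; exact: cvg_id].
      rewrite scale0r addr0 in l0.
      by apply: cvg_trans l0; apply: cvg_app; exact: nbhs_dnbhs.
    exact: (cvg_comp _ _ l0 cl).
  rewrite (_ : \sum_j _ = (\sum_j u 0 j * ((count_mem j w)%:R *
      xword (rem j w) x)) * g m (enorm x)); last first.
    by rewrite mulr_suml; apply: eq_bigr => j _; rewrite /radial; ring.
  rewrite (_ : (fun h => _) = (fun h => h^-1 * (xword w (x + h *: u) -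
      xword w x) * g m (enorm (x + h *: u)))); first exact: (cvgM H1 H2).
  by apply/funext => h; rewrite /radial xw0 mul0r !subr0 mulrA.
have {}w0 : w = [::] by apply: size0nil; lia.
rewrite w0 /= addn0 in mw *.
rewrite big1 => [|j _]; last by rewrite mul0r mulr0.
have [u0|u0] := eqVneq u 0; first by rewrite u0; exact: is_derive0.
have c0 : 0 < enorm u by rewrite enorm_gt0.
(* With an empty word [g m] itself has derivative 0 at 0; its quotient is taken at the increment
   [|h| * enorm u], the norm of [h *: u]. *)
have mn' : (m < n)%N by lia.
have /is_derive_cvg := g_derive0 mn'.
move=> H; apply/is_derive_cvg/cvgrPdist_le => /= e e0.
have ec0 : 0 < e / enorm u by rewrite divr_gt0.
move/cvgrPdist_le : H => /(_ _ ec0) /= [r /= r0 H].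
exists (r / enorm u) => /=; first by rewrite divr_gt0.
move=> h /=; rewrite sub0r normrN ltr_pdivlMr // => hr h0.
have := H (`|h| * enorm u).
rewrite /= sub0r normrN normrM normr_id (gtr0_norm c0) => /(_ hr).
have nz : `|h| * enorm u != 0 by rewrite mulf_neq0 ?normr_eq0 // gt_eqF.
move=> /(_ nz).
rewrite !sub0r !normrN !add0r [(_ *: 1 : R)]mulr1 /radial /xword !big_nil !mul1r.
rewrite x0 add0r enormZ enorm0 !normrM !normfV !normrM normr_id (gtr0_norm c0).
rewrite ler_pdivrMl ?mulr_gt0 ?normr_gt0 // => H'.
rewrite ler_pdivrMl ?normr_gt0 //; apply: (le_trans H').
by rewrite -mulrA [enorm u * _]mulrC divfK ?gt_eqF.
Qed.

(** A derivative either removes a letter of [w], or adds one while raising [m]. Both lower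
    [size w - 2 * m] by one, so the second inequality passes from [M.+1] to [M]. *)
Lemma radial_Cr M w m : (M + m <= 2 * n)%N -> (M + 2 * m <= 2 * n + size w)%N ->
  Cr M (radial w m).
Proof.
elim: M w m => [|M IH] w m h1 h2; first by split=> //; exact: radial_continuous.
apply: (CrS (Fj := fun j x =>
  (count_mem j w)%:R * radial (rem j w) m x + radial (j :: w) m.+1 x)).
- by apply: radial_continuous; lia.
- by move=> x u; apply: radial_derive; lia.
move=> j; apply: CrD; last by apply: IH => /=; lia.
have [jw|jw] := boolP (j \in w).
  have sw := size_rem jw; apply: CrZ; apply: IH; first lia.
  by rewrite sw; move: h2; case: (size w) => [|k] /=; lia.
rewrite (count_memPn jw) (_ : (fun _ => _) = cst 0); first exact: Cr_cst.
by apply/funext => x; rewrite mul0r.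
Qed.

End Radial.

(** * Smoothness of Wendland's functions *)

Section Wendland.
Context {R : realType} (d n : nat).

Let l := (d./2 + n + 1)%N.

Definition wpsi (j : nat) : R -> R := iter j wint (truncpow l).

Lemma wpsi_eq0 j t : 1 <= t -> wpsi j t = 0.
Proof.
elim: j t => [|j IH] t t1; first by rewrite /wpsi /= truncpow_eq0 // /l addn1.
by rewrite /wpsi /=; apply: wint_eq0 => // s s1; exact: IH.
Qed.

Lemma wpsi_continuous j : continuous (wpsi j).
Proof.
elim: j => [|j IH]; first exact: truncpow_continuous.
apply: (@is_derive_continuous _ _ (fun t => - (t * wpsi j t))) => t.
by apply: wint_derive => // s; exact: wpsi_eq0.
Qed.

Lemma wpsi_derive j (t : R) : is_derive t 1 (wpsi j.+1) (- (t * wpsi j t)).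
Proof. by apply: wint_derive; [exact: wpsi_continuous|exact: wpsi_eq0]. Qed.

(* [truncpow (l - k) r * (wsing_poly k).[r] / r ^+ (2 * k).-1] is what remains
   of [truncpow l] after [k >= 1] applications of [f |-> f^`() / r]. *)
Fixpoint wsing_poly (k : nat) : {poly R} :=
  if k is k'.+1 then
    if k' is 0%N then (- l%:R)%:P
    else - ((l - k')%:R *: ('X * wsing_poly k'))
         + (1 - 'X) * ('X * (wsing_poly k')^`() - (2 * k').-1%:R *: wsing_poly k')
  else 0.

Definition wsing k (r : R) : R :=
  truncpow (l - k) r * (wsing_poly k).[r] / r ^+ (2 * k).-1.

(** The iterates of [f |-> f' / r] on Wendland's profile: each of the first [n] undoes one [wint] up
    to sign, and the later ones act on the truncated power that remains. *)
Definition wprofile (m : nat) (r : R) : R :=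
  if (m <= n)%N then (-1) ^+ m * wpsi (n - m) r
  else (-1) ^+ n * wsing (m - n) r.

Lemma horner_derive (p : {poly R}) (r : R) : is_derive r 1 (horner p) p^`().[r].
Proof.
by apply: DeriveDef; [exact: derivable_horner|rewrite -derive1E -derivE].
Qed.

Lemma wsing_continuous k (r : R) : 0 < r -> {for r, continuous (wsing k)}.
Proof.
move=> r0; apply: cvgM.
  by apply: cvgM; [exact: truncpow_continuous|exact: continuous_horner].
apply: cvgV; first by rewrite expf_neq0 // gt_eqF.
exact: exprn_continuous.
Qed.

Lemma truncpowS a (r : R) : truncpow a.+2 r = (1 - r) * truncpow a.+1 r.
Proof.
rewrite /truncpow exprS; have [//|_] := leP 0 (1 - r).
by rewrite expr0n !mulr0.
Qed.

Lemma wsing_derive k (r : R) : (0 < k < n)%N -> 0 < r ->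
  is_derive r 1 (wsing k) (r * wsing k.+1 r).
Proof.
move=> /andP[k0 kn] r0.
(* [k < n] leaves an exponent of at least 2, for which the truncated power is differentiable at its
   kink. *)
have [a la] : exists a, (l - k = a.+2)%N.
  by exists (l - k).-2; rewrite /l; lia.
have la' : (l - k.+1 = a.+1)%N by lia.
have rk : r ^+ (2 * k).-1 != 0 by rewrite expf_neq0 // gt_eqF.
have D1 := is_deriveM (truncpow_derive a r) (horner_derive (wsing_poly k) r).
have DX : is_derive r 1 (fun s : R => s ^+ (2 * k).-1)
    ((2 * k).-1%:R * r ^+ (2 * k).-2).
  have := is_deriveX (2 * k).-1 (is_derive_id r (1 : R)).
  rewrite (_ : id ^+ _ = fun s : R => s ^+ (2 * k).-1).
    by rewrite /GRing.scale /= mulr1.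
  by apply/funext => s; rewrite fctE.
have D2 := is_deriveV (f := fun s : R => s ^+ (2 * k).-1) rk DX.
have := is_deriveM D1 D2.
rewrite (_ : _ * _ = wsing k); last first.
  by apply/funext => s; rewrite /wsing la !fctE.
move=> D; apply: (is_derive_eq D); rewrite /GRing.scale /= !fctE.
rewrite /wsing la' -/wsing_poly.
case: k k0 kn la la' rk {D D1 D2 DX} => // k _ kn la la' rk.
rewrite [in RHS]/wsing_poly -/wsing_poly.
rewrite hornerD hornerN hornerZ hornerM hornerX hornerM !hornerE.
rewrite truncpowS la.
have -> : (2 * k.+1).-1 = (2 * k).+1 by lia.
have -> : (2 * k.+2).-1 = (2 * k).+3 by lia.
rewrite /= !exprS; field.
by rewrite expf_neq0 gt_eqF.
Qed.

Lemma wsing_bound k : (0 < k <= n)%N -> exists2 C : R, 0 <= C &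
  forall r : R, 0 < r -> `|r ^+ (2 * k).-1 * wsing k r| <= C.
Proof.
move=> /andP[k0 kn].
exists (\sum_(i < size (wsing_poly k)) `|(wsing_poly k)`_i|); first exact: sumr_ge0.
move=> r r0; rewrite /wsing mulrC divfK ?expf_neq0 ?gt_eqF //.
have [r1|r1] := leP 1 r.
  by rewrite truncpow_eq0 ?mul0r ?normr0 ?sumr_ge0 // /l; lia.
rewrite normrM -[leRHS]mul1r ler_pM //.
  have r1' : 0 <= 1 - r by rewrite subr_ge0 ltW.
  rewrite /truncpow max_l // normrX exprn_ile1 //.
  by rewrite ger0_norm // gerBl ltW.
rewrite horner_coef; apply: (le_trans (ler_norm_sum _ _ _)).
apply: ler_sum => i _; rewrite normrM normrX -[leRHS]mulr1 ler_wpM2l //.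
by rewrite exprn_ile1 // gtr0_norm // ltW.
Qed.

Lemma wprofile_continuous m (r : R) : 0 < r -> {for r, continuous (wprofile m)}.
Proof.
move=> r0; rewrite /wprofile; case: leqP => _; apply: continuousZ_for.
  exact: wpsi_continuous.
exact: wsing_continuous.
Qed.

Lemma wprofile_derive_lt m (t : R) : (m < n)%N ->
  is_derive t 1 (wprofile m) (t * wprofile m.+1 t).
Proof.
move=> mn; rewrite /wprofile (ltnW mn) mn.
have := @is_deriveZ _ _ _ _ ((-1) ^+ m) _ _ _ (wpsi_derive (n - m.+1) t).
rewrite subnSK // => h; apply: (is_derive_eq h).
by rewrite /GRing.scale /= exprS; ring.
Qed.

Lemma wprofile_derive m (r : R) : (m < 2 * n)%N -> 0 < r ->
  is_derive r 1 (wprofile m) (r * wprofile m.+1 r).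
Proof.
move=> mn r0; have [m_n|n_m] := ltnP m n; first exact: wprofile_derive_lt.
rewrite {2}/wprofile ltnNge n_m /=.
have [mn'|mn'] := eqVneq m n.
  rewrite mn' /wprofile leqnn subnn subSnn /wpsi /=.
  have la : (l = (l - 2).+2)%N by rewrite /l; lia.
  rewrite la; have h := truncpow_derive (l - 2) r.
  have := @is_deriveZ _ _ _ _ ((-1) ^+ n) _ _ _ h.
  move=> {}h; apply: (is_derive_eq h).
  rewrite /wsing /wsing_poly /= hornerC expr1 la subn1 /= -la.
  rewrite /GRing.scale /= -{1}la; move: (truncpow _ r) => T; field.
  by rewrite gt_eqF.
rewrite /wprofile leqNgt ltn_neqAle eq_sym mn' n_m /=.
have h := @wsing_derive (m - n) r ltac:(lia) r0.
have := @is_deriveZ _ _ _ _ ((-1) ^+ n) _ _ _ h => {}h.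
apply: (is_derive_eq h); rewrite subSn // /GRing.scale /=; ring.
Qed.

Lemma wendland_Cr : Cr (2 * n) (@wendland R d n).
Proof.
have -> : @wendland R d n = radial wprofile [::] 0.
  apply/funext => x; rewrite /radial /xword big_nil /wprofile /= mul1r expr0 mul1r.
  by rewrite subn0.
apply: (@radial_Cr _ _ n); rewrite ?addn0 //.
- by move=> m r _; exact: wprofile_continuous.
- by move=> m r; exact: wprofile_derive.
- move=> m mn; rewrite /wprofile mn.
  apply: continuousZ_for; exact: wpsi_continuous.
- by move=> m mn; apply: (is_derive_eq (wprofile_derive_lt 0 mn)); rewrite mul0r.
(* The value at 0 is the convention that the inverse of 0 is 0: the exponent of [r] in the
   denominator of [wsing] is positive. *)
- move=> m nm; rewrite /wprofile leqNgt nm /= /wsing expr0n.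
  have -> : (2 * (m - n)).-1 == 0%N = false by lia.
  by rewrite invr0 !mulr0.
- move=> m nm; have [C C0 hC] := @wsing_bound (m - n) ltac:(lia).
  exists C => // r r0; rewrite /wprofile leqNgt; case/andP: nm => -> _ /=.
  by rewrite mulrCA normrM normrX normrN1 expr1n mul1r hC.
Qed.

End Wendland.

(** * Duality for the weights *)

Section Duality.
Context {R : realType}.

(** A line through [(th, rho)] above [A]. Its slope is the supremum of the slopes from [(th, rho)]
    to the points of [A] on its right; these are at most the slopes to the points on its left,
    because a segment of [A] crosses the abscissa [th] at height at most [rho]. Symmetry provides a
    point on the left, and the last hypothesis makes the slope positive. *)
Let slope_sep (A : R -> R -> Prop) (th rho : R) : 0 <= th ->
  (forall t1 f1 t2 f2 c, A t1 f1 -> A t2 f2 -> 0 <= c <= 1 ->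
     A (c * t1 + (1 - c) * t2) (c * f1 + (1 - c) * f2)) ->
  (forall t f, A t f -> A (- t) (- f)) ->
  (forall t f, A t f -> `|t| <= th -> f <= rho) ->
  (exists t f, [/\ A t f, th < t & rho < f]) ->
  exists w, forall t f, A t f -> f - w * t <= rho - `|w| * th.
Proof.
move=> th0 Acvx Asym Arho [t0 [f0 [A0 t0th f0rho]]].
have cross t1 f1 t2 f2 : A t1 f1 -> A t2 f2 -> t1 < th -> th < t2 ->
    (f2 - rho) / (t2 - th) <= (rho - f1) / (th - t1).
  move=> A1 A2 h1 h2; have h12 : 0 < t2 - t1 by rewrite subr_gt0 (lt_trans h1).
  rewrite ler_pdivrMr ?subr_gt0 // mulrAC ler_pdivlMr ?subr_gt0 //.
  pose c := (t2 - th) / (t2 - t1).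
  have c01 : 0 <= c <= 1.
    apply/andP; split; first by rewrite divr_ge0 ?subr_ge0 ?(ltW h2) ?(ltW h12) // ltW // -subr_gt0.
    by rewrite ler_pdivrMr // mul1r lerB // ltW.
  have Ec : c * t1 + (1 - c) * t2 = th by rewrite /c; field; rewrite gt_eqF.
  have := Arho _ _ (Acvx _ _ _ _ _ A1 A2 c01); rewrite Ec ger0_norm // lexx.
  move=> /(_ isT); rewrite -(ler_pM2r h12).
  have -> : (c * f1 + (1 - c) * f2) * (t2 - t1) =
      (t2 - th) * f1 + (th - t1) * f2 by rewrite /c; field; rewrite gt_eqF.
  lra.
pose B := [set r | exists t f, [/\ A t f, th < t & r = (f - rho) / (t - th)]].
have B0 : B ((f0 - rho) / (t0 - th)) by exists t0, f0.
have ubB t f : A t f -> t < th -> ubound B ((rho - f) / (th - t)).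
  by move=> Atf tth _ [t' [f' [A' th' ->]]]; exact: cross.
have hB : has_sup B.
  split; first by exists ((f0 - rho) / (t0 - th)).
  exists ((rho - - f0) / (th - - t0)); apply: ubB; first exact: Asym.
  lra.
have wlb r : B r -> r <= sup B by move=> Br; exact: sup_upper_bound.
have w0 : 0 < sup B.
  by apply: (lt_le_trans _ (wlb _ B0)); rewrite divr_gt0 ?subr_gt0.
exists (sup B) => t f Atf; rewrite (gtr0_norm w0).
have [tth|tth|tth] := ltgtP t th.
- have : sup B <= (rho - f) / (th - t).
    by apply: ge_sup; [case: hB|exact: ubB].
  rewrite ler_pdivlMr ?subr_gt0 //; lra.
- have : (f - rho) / (t - th) <= sup B by apply: wlb; exists t, f.
  rewrite ler_pdivrMr ?subr_gt0 //; lra.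
- have := Arho _ _ Atf; rewrite tth ger0_norm // lexx => /(_ isT); lra.
Qed.

(** Points higher than [rho] on the right of [th] are handled by [slope_sep], those on the left of
    [- th] by its reflection; if there are none, the horizontal line works. *)
Lemma line_separation (A : R -> R -> Prop) (th rho : R) : 0 <= th ->
  (forall t1 f1 t2 f2 c, A t1 f1 -> A t2 f2 -> 0 <= c <= 1 ->
     A (c * t1 + (1 - c) * t2) (c * f1 + (1 - c) * f2)) ->
  (forall t f, A t f -> A (- t) (- f)) ->
  (forall t f, A t f -> `|t| <= th -> f <= rho) ->
  exists w, forall t f, A t f -> f - w * t <= rho - `|w| * th.
Proof.
move=> th0 Acvx Asym Arho.
have [h|h1] := pselect (exists t f, [/\ A t f, th < t & rho < f]).
  exact: slope_sep.
have [[t [f [Atf tth fr]]]|h2] :=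
    pselect (exists t f, [/\ A t f, t < - th & rho < f]).
  have [||||w hw] := @slope_sep (fun t f => A (- t) f) th rho th0.
  - move=> t1 f1 t2 f2 c A1 A2 c01.
    rewrite (_ : - _ = c * - t1 + (1 - c) * - t2); last by ring.
    exact: Acvx.
  - by move=> t' f' /Asym.
  - by move=> t' f' /Arho; rewrite normrN.
  - by exists (- t), f; rewrite opprK; split=> //; rewrite ltrNr.
  exists (- w) => t' f' A'; rewrite normrN.
  by have := hw (- t') f'; rewrite opprK => /(_ A'); rewrite mulrN mulNr.
exists 0 => t f Atf; rewrite mul0r normr0 mul0r !subr0.
rewrite leNgt; apply/negP => fr.
have [tth|tth] := ltP th t; first by apply: h1; exists t, f.
have [tth'|tth'] := ltP t (- th); first by apply: h2; exists t, f.
have := Arho _ _ Atf; rewrite ler_norml tth tth' => /(_ isT).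
by rewrite leNgt fr.
Qed.

(** Constraints are eliminated one at a time. The vectors satisfying all constraints but the first
    have a convex symmetric image under [(e ord0, F)] in the plane; a separating line of slope [w0]
    shows that [F - w0 * e ord0] is at most [rho - |w0| * th ord0] under the others. Linearity is
    required only on the subspace [S]. *)
Lemma weight_duality (V : lmodType R) (S : V -> Prop) (N : nat) (F : V -> R)
    (e : 'I_N -> V -> R) (th : 'I_N -> R) (rho : R) :
  S 0 -> (forall c u v, S u -> S v -> S (c *: u + v)) ->
  (forall c u v, S u -> S v -> F (c *: u + v) = c * F u + F v) ->
  (forall j c u v, S u -> S v -> e j (c *: u + v) = c * e j u + e j v) ->
  (forall j, 0 <= th j) ->
  (forall u, S u -> (forall j, `|e j u| <= th j) -> F u <= rho) ->
  exists w : 'I_N -> R, (forall u, S u -> F u = \sum_j w j * e j u) /\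
    \sum_j `|w j| * th j <= rho.
Proof.
move=> S0 Slin Flin elin th0.
have SZ c u : S u -> S (c *: u) by move=> Su; rewrite -[_ *: u]addr0; exact: Slin.
have lin0 G : (forall c u v, S u -> S v -> G (c *: u + v) = c * G u + G v) ->
    forall c u, S u -> G (c *: u) = c * G u :> R.
  move=> Gl; have G0 : G 0 = 0.
    by have := Gl 1 _ _ S0 S0; rewrite scale1r addr0 mul1r; lra.
  by move=> c u Su; rewrite -[_ *: u]addr0 Gl // G0 addr0.
elim: N F e th rho Flin elin th0 => [|N IH] F e th rho Flin elin th0 H.
  have Fle u : S u -> F u <= rho by move=> Su; apply: H => // -[].
  exists (fun _ => 0); split; last by rewrite big_ord0 -(mul0r (F 0)) -(lin0 _ Flin) // scale0r Fle.
  (* Without constraints [F] is bounded above on a subspace, hence zero there: otherwise some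
     multiple of [u] would reach [rho + 1]. *)
  move=> u Su; rewrite big_ord0; apply/eqP/negPn/negP => Fu.
  have := Fle _ (SZ ((rho + 1) / F u) _ Su).
  by rewrite (lin0 _ Flin) // divfK // gerDl ler10.
pose C u := S u /\ forall j, `|e (lift ord0 j) u| <= th (lift ord0 j).
pose A t f := exists u, [/\ C u, e ord0 u = t & F u = f].
have [||||w0 hw0] := @line_separation A (th ord0) rho.
- exact: th0.
- move=> _ _ _ _ c [u [[Su Cu] <- <-]] [v [[Sv Cv] <- <-]] /andP[c0 c1].
  have c1' : 0 <= 1 - c by rewrite subr_ge0.
  exists (c *: u + (1 - c) *: v); split.
  + split=> [|j]; first by apply: Slin => //; exact: SZ.
    rewrite elin //; last exact: SZ.
    rewrite (lin0 _ (elin _)) //; apply: (le_trans (ler_normD _ _)).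
    rewrite !normrM (ger0_norm c0) (ger0_norm c1').
    rewrite (_ : th (lift ord0 j) = c * th (lift ord0 j) + (1 - c) * th (lift ord0 j)).
      by apply: lerD; apply: ler_wpM2l.
    ring.
  + by rewrite elin //; [rewrite (lin0 _ (elin _))|exact: SZ].
  + by rewrite Flin //; [rewrite (lin0 _ Flin)|exact: SZ].
- move=> _ _ [u [[Su Cu] <- <-]]; exists (-1 *: u); split.
  + split=> [|j]; first exact: SZ.
    by rewrite (lin0 _ (elin _)) // mulN1r normrN.
  + by rewrite (lin0 _ (elin _)) // mulN1r.
  + by rewrite (lin0 _ Flin) // mulN1r.
- move=> _ _ [u [[Su Cu] <- <-]] u0; apply: H => // j.
  by case: (unliftP ord0 j) => [j' ->|->].
have [||||w [hw1 hw2]] := IH (fun u => F u - w0 * e ord0 u)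
    (fun j => e (lift ord0 j)) (fun j => th (lift ord0 j)) (rho - `|w0| * th ord0).
- by move=> c u v Su Sv; rewrite Flin // elin //; ring.
- by move=> j; exact: elin.
- by move=> j; exact: th0.
- by move=> u Su Cu; apply: hw0; exists u.
exists (fun j => if unlift ord0 j is Some j' then w j' else w0); split.
  move=> u Su; rewrite big_ord_recl unlift_none.
  under eq_bigr do rewrite liftK.
  by rewrite -hw1 //; ring.
rewrite big_ord_recl unlift_none; under eq_bigr do rewrite liftK.
by rewrite addrC -lerBrDr.
Qed.

End Duality.

(** * Limits of functionals *)

Section Functionals.
Context {R : realType} {T : eqType}.
Implicit Types (G : T -> R) (k : T -> T -> R) (L : seq (R * T)).

(** A list stands for a formal combination of labels in [T], a label possibly repeated; functions
    and kernels on [T] extend to such combinations linearly. *)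
Definition app G L : R := \sum_(a <- L) a.1 * G a.2.

Definition bil k L L' : R := \sum_(a <- L) a.1 * app (k a.2) L'.

Definition scalL (c : R) L : seq (R * T) := [seq (c * a.1, a.2) | a <- L].

Lemma app_cat G L L' : app G (L ++ L') = app G L + app G L'.
Proof. exact: big_cat. Qed.

Lemma app_scal G c L : app G (scalL c L) = c * app G L.
Proof.
by rewrite /app big_map mulr_sumr; apply: eq_bigr => a _; rewrite mulrA.
Qed.

Lemma app_cons G a L : app G (a :: L) = a.1 * G a.2 + app G L.
Proof. exact: big_cons. Qed.

Lemma app_nil G : app G [::] = 0.
Proof. exact: big_nil. Qed.

Lemma eq_app G G' L : (forall a, a \in L -> G a.2 = G' a.2) -> app G L = app G' L.
Proof. by move=> h; apply: eq_big_seq => a /h ->. Qed.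

Lemma appD G G' L : app (fun t => G t + G' t) L = app G L + app G' L.
Proof. by rewrite -big_split; apply: eq_bigr => a _; rewrite mulrDr. Qed.

Lemma appZ c G L : app (fun t => c * G t) L = c * app G L.
Proof. by rewrite mulr_sumr; apply: eq_bigr => a _; rewrite mulrCA. Qed.

Lemma app_sum (I : Type) (r : seq I) (c : I -> R) (H : I -> T -> R) L :
  app (fun t => \sum_(b <- r) c b * H b t) L = \sum_(b <- r) c b * app (H b) L.
Proof.
under [RHS]eq_bigr do rewrite -appZ.
rewrite /app exchange_big; apply: eq_bigr => a _.
by rewrite mulr_sumr.
Qed.

Lemma bilE k L L' : bil k L L' = app (fun t => app (k t) L') L.
Proof. by []. Qed.

Lemma bil_cat k L1 L2 : bil k (L1 ++ L2) (L1 ++ L2) =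
  bil k L1 L1 + bil k L1 L2 + (bil k L2 L1 + bil k L2 L2).
Proof.
rewrite !bilE app_cat -!appD.
by congr (_ + _); apply: eq_app => a _; rewrite app_cat.
Qed.

Lemma bil_scall k c L L' : bil k (scalL c L) L' = c * bil k L L'.
Proof. by rewrite bilE app_scal. Qed.

Lemma bil_scalr k c L L' : bil k L (scalL c L') = c * bil k L L'.
Proof. by rewrite !bilE -appZ; apply: eq_app => a _; rewrite app_scal. Qed.

Definition form_bound (S : T -> Prop) G k (C : R) : Prop :=
  forall L, (forall a, a \in L -> S a.2) ->
    `|app G L| <= C * Num.sqrt (bil k L L).

Lemma cvg_sum_seq (I : eqType) (U : Type) (F : set_system U) {FF : Filter F}
    (r : seq I) (f : I -> U -> R) (l : I -> R) :
  (forall i, i \in r -> f i x @[x --> F] --> l i) ->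
  \sum_(i <- r) f i x @[x --> F] --> \sum_(i <- r) l i.
Proof.
elim: r => [|i r IH] h.
  rewrite big_nil; under eq_fun do rewrite big_nil; exact: cvg_cst.
rewrite big_cons; under eq_fun do rewrite big_cons.
apply: (cvgD (h i (mem_head _ _))).
by apply: IH => j jr; apply: h; rewrite in_cons jr orbT.
Qed.

Lemma bil_sums k L L' : bil k L L' =
  \sum_(a <- L) \sum_(b <- L') a.1 * b.1 * k a.2 b.2.
Proof.
apply: eq_bigr => a _; rewrite /app mulr_sumr.
by apply: eq_bigr => b _; rewrite mulrA.
Qed.

Section Limit.
Variables (S S' : T -> Prop) (G : T -> R) (k : T -> T -> R) (C : R).
Variable tau : T -> R -> seq (R * T).
Hypothesis C0 : 0 <= C.
Hypothesis GB : form_bound S G k C.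
Hypothesis tauS : forall t h, S' t -> forall a, a \in tau t h -> S a.2.
Hypothesis tau_lim : forall t t', S' t -> S' t' -> forall e : R, 0 < e ->
  exists2 r : R, 0 < r & forall h h', h != 0 -> h' != 0 -> `|h| < r -> `|h'| < r ->
    `|bil k (tau t h) (tau t' h') - k t t'| < e.

(** The form of [tau t h - tau t h'] tends to [k t t - k t t - k t t + k t t = 0], so by [GB] the
    values of [G] are Cauchy. *)
Lemma limit_functional_cvg t : S' t ->
  cvg (app G (tau t h) @[h --> (0 : R)^']).
Proof.
move=> St; apply/cauchy_cvgP; apply: cauchy_exP => e e0.
(* Four values of the form, each off by less than [e1], add up to less than half of the square;
   [C + 1] avoids dividing by 0. *)
pose e1 := (e / (C + 1)) ^+ 2 / 8.
have C1 : 0 < C + 1 by rewrite ltr_wpDl.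
have ec : 0 < e / (C + 1) by rewrite divr_gt0.
have e10 : 0 < e1 by rewrite divr_gt0 ?exprn_gt0.
have [r r0 hr] := tau_lim St St e10.
have r20 : r / 2 != 0 by rewrite gt_eqF // divr_gt0.
have r2r : `|r / 2| < r by rewrite gtr0_norm ?divr_gt0 //; lra.
exists (app G (tau t (r / 2))).
exists r => //= h /=; rewrite sub0r normrN /ball /= => hr' h0.
pose L := tau t (r / 2) ++ scalL (-1) (tau t h).
have SL a : a \in L -> S a.2.
  rewrite mem_cat => /orP[|/mapP[b bt ->]]; [exact: tauS|exact: (tauS St bt)].
have := GB SL; rewrite app_cat app_scal mulN1r => H; apply: (le_lt_trans H).
have BL : bil k L L < (e / (C + 1)) ^+ 2.
  rewrite /L bil_cat !(bil_scall, bil_scalr).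
  have := hr _ _ r20 r20 r2r r2r; have := hr _ _ r20 h0 r2r hr'.
  have := hr _ _ h0 r20 hr' r2r; have := hr _ _ h0 h0 hr' hr'.
  rewrite !ltr_distl /e1; set E := _ ^+ 2; lra.
apply: (@le_lt_trans _ _ (C * (e / (C + 1)))).
  apply: ler_wpM2l => //; have := ler_wsqrtr (ltW BL).
  by rewrite sqrtr_sqr gtr0_norm.
by rewrite mulrC -mulrA gtr_pMr // mulrC ltr_pdivrMr // mul1r ltrDl.
Qed.

(** Each label of [L] is replaced by its approximation; both sides of the bound for [S] then
    converge. *)
Lemma limit_functional_bound :
  form_bound S' (fun t => lim (app G (tau t h) @[h --> (0 : R)^'])) k C.
Proof.
move=> L SL; set G' := (fun t => lim _).
pose Lh h : seq (R * T) := flatten [seq scalL a.1 (tau a.2 h) | a <- L].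
have appLh (G1 : T -> R) h : app G1 (Lh h) = \sum_(a <- L) a.1 * app G1 (tau a.2 h).
  rewrite /Lh; elim: (L) => [|a L' IH] /=; first by rewrite app_nil big_nil.
  by rewrite app_cat IH big_cons app_scal.
have c1 : `|app G (Lh h)| @[h --> (0 : R)^'] --> `|app G' L|.
  apply: cvg_norm; under eq_fun do rewrite appLh.
  apply: cvg_sum_seq => a aL.
  exact: (cvgM (cvg_cst a.1) (limit_functional_cvg (SL _ aL))).
have c2 : bil k (Lh h) (Lh h) @[h --> (0 : R)^'] --> bil k L L.
  have E h : bil k (Lh h) (Lh h) = \sum_(a <- L) \sum_(b <- L)
      a.1 * b.1 * bil k (tau a.2 h) (tau b.2 h).
    rewrite bilE appLh; apply: eq_bigr => a _.
    under [X in app X _]eq_fun do rewrite appLh.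
    rewrite app_sum mulr_sumr; apply: eq_bigr => b _; exact: mulrA.
  under eq_fun do rewrite E; rewrite bil_sums.
  apply: cvg_sum_seq => a aL; apply: cvg_sum_seq => b bL.
  suff H : bil k (tau a.2 h) (tau b.2 h) @[h --> (0 : R)^'] --> k a.2 b.2.
    exact: (cvgM (cvg_cst (a.1 * b.1)) H).
  apply/cvgrPdist_lt => /= e e0.
  have [r r0 hr] := tau_lim (SL _ aL) (SL _ bL) e0.
  exists r => //= h /=; rewrite sub0r normrN => hr' h0.
  by rewrite distrC; apply: hr.
have c3 : C * Num.sqrt (bil k (Lh h) (Lh h)) @[h --> (0 : R)^'] -->
    C * Num.sqrt (bil k L L).
  exact: (cvgM (cvg_cst C) (cvg_comp _ _ c2 (@sqrt_continuous R _))).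
apply: (ler_cvg_to c1 c3); near=> h; apply: GB => a.
move=> /flatten_mapP[b bL /mapP[a' a't ->]].
exact: (tauS (SL _ bL) a't).
Unshelve. all: by end_near. Qed.

End Limit.
End Functionals.

(** * Derivatives of native space functions *)

Section NativeDerivatives.
Context {R : realType} {d : nat}.

Notation site := (seq 'I_d * 'rV[R]_d)%type.
Implicit Types (t : site) (L : seq (R * site)) (g : 'rV[R]_d -> R).

Definition dsite g t : R := dword t.1 g t.2.

Definition shift_site t (u : 'rV[R]_d) (h : R) : site := (t.1, t.2 + h *: u).

Definition cons_site (i : 'I_d) t : site := (i :: t.1, t.2).

Lemma shift_site0 t u : shift_site t u 0 = t.
Proof. by case: t => w y; rewrite /shift_site /= scale0r addr0. Qed.

Lemma shift_site_dir0 t h : shift_site t 0 h = t.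
Proof. by case: t => w y; rewrite /shift_site /= scaler0 addr0. Qed.

(* [k t t'] is to be thought of as the derivative of a two-point kernel along
   the word [t.1] in its first and [t'.1] in its second argument. *)
Definition smooth_kernel (n : nat) (k : site -> site -> R) : Prop :=
  [/\ forall t t' i (h : R), (size t.1 < n)%N -> (size t'.1 <= n)%N ->
        is_derive h 1 (fun s : R => k (shift_site t (delta_mx 0 i) s) t')
          (k (cons_site i (shift_site t (delta_mx 0 i) h)) t'),
      forall t t' i (h : R), (size t.1 <= n)%N -> (size t'.1 < n)%N ->
        is_derive h 1 (fun s : R => k t (shift_site t' (delta_mx 0 i) s))
          (k t (cons_site i (shift_site t' (delta_mx 0 i) h))) &
      forall t t' u u', (size t.1 <= n)%N -> (size t'.1 <= n)%N ->
        k (shift_site t u p.1) (shift_site t' u' p.2)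
          @[p --> ((0 : R), (0 : R))] --> k t t'].

Lemma smooth_kernel_near n k t t' u u' : smooth_kernel n k ->
  (size t.1 <= n)%N -> (size t'.1 <= n)%N -> forall e : R, 0 < e ->
  exists2 r : R, 0 < r & forall s s' : R, `|s| < r -> `|s'| < r ->
    `|k (shift_site t u s) (shift_site t' u' s') - k t t'| < e.
Proof.
move=> [_ _ K3] tn tn' e e0.
have /cvgrPdist_lt /(_ e e0) := K3 t t' u u' tn tn'.
rewrite /= => /nbhs_ballP[r /= r0 H]; exists r => // s s' sr sr'.
by rewrite distrC; apply: (H (s, s')); split; rewrite /= /ball /= sub0r normrN.
Qed.

(** A derivative functional is approximated by functionals with one letter fewer; point evaluations
    are left as they are, so that lists mixing all orders can be treated at once. *)
Definition quotient_site t (h : R) : seq (R * site) :=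
  if t.1 is i :: w then
    [:: (h^-1, shift_site (w, t.2) (delta_mx 0 i) h); (- h^-1, (w, t.2))]
  else [:: (1, t)].

(** Mean value theorems turn the form of two quotients into a single value of [k] at sites displaced
    by at most [|h|] and [|h'|], and [k] is jointly continuous. Direction 0 encodes an empty word,
    whose site does not move. *)
Lemma quotient_site_lim n k t t' : smooth_kernel n k ->
  (size t.1 <= n)%N -> (size t'.1 <= n)%N -> forall e : R, 0 < e ->
  exists2 r : R, 0 < r & forall h h', h != 0 -> h' != 0 -> `|h| < r -> `|h'| < r ->
    `|bil k (quotient_site t h) (quotient_site t' h') - k t t'| < e.
Proof.
move=> sk tn tn' e e0; have [K1 K2 _] := sk.
pose dir (v : site) : 'rV[R]_d := if v.1 is i :: _ then delta_mx 0 i else 0.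
have [r r0 H] := smooth_kernel_near (dir t) (dir t') sk tn tn' e0.
exists r => // h h' h0 h'0 hr h'r.
have z0 : `|0 : R| < r by rewrite normr0.
suff [s [s' [sh sh' E]]] : exists s s', [/\ `|s| <= `|h|, `|s'| <= `|h'| &
    bil k (quotient_site t h) (quotient_site t' h')
    = k (shift_site t (dir t) s) (shift_site t' (dir t') s')].
  by rewrite E; apply: H; [exact: le_lt_trans hr|exact: le_lt_trans h'r].
case: t t' tn tn' {H} => [[|i w] y] [[|i' w'] y'] /= tn tn';
  rewrite /quotient_site /= /bil /app !big_cons !big_nil /= ?addr0 ?mul1r.
- by exists 0, 0; rewrite normr0 !normr_ge0 !shift_site0; split.
- have [c ch E] := MVT0 h' (fun s => K2 ([::], y) (w', y') i' s tn tn').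
  exists 0, c; rewrite normr0 normr_ge0 ch shift_site0; split=> //.
  rewrite shift_site0 in E.
  by rewrite mulNr -mulrBr E mulrC -mulrA mulfV // mulr1.
- have [c ch E] := MVT0 h (fun s => K1 (w, y) ([::], y') i s tn tn').
  exists c, 0; rewrite normr0 normr_ge0 ch shift_site0; split=> //.
  rewrite shift_site0 in E.
  by rewrite mulNr -mulrBr E mulrC -mulrA mulfV // mulr1.
have [s [s' [sh sh' E]]] := @double_MVT R
  (fun s s' => k (shift_site (w, y) (delta_mx 0 i) s)
    (shift_site (w', y') (delta_mx 0 i') s'))
  (fun s s' => k (cons_site i (shift_site (w, y) (delta_mx 0 i) s))
    (shift_site (w', y') (delta_mx 0 i') s'))
  (fun s s' => k (cons_site i (shift_site (w, y) (delta_mx 0 i) s))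
    (cons_site i' (shift_site (w', y') (delta_mx 0 i') s'))) h h'
  (fun s s' => K1 (w, y) (shift_site (w', y') (delta_mx 0 i') s') i s tn (ltnW tn'))
  (fun s s' => K2 (cons_site i (shift_site (w, y) (delta_mx 0 i) s)) (w', y') i' s' tn tn').
exists s, s'; split=> //; rewrite !shift_site0 in E.
transitivity (h^-1 * h'^-1 * (h * h' *
    k (cons_site i (shift_site (w, y) (delta_mx 0 i) s))
      (cons_site i' (shift_site (w', y') (delta_mx 0 i') s')))).
  by rewrite -E; ring.
set D := k _ _; rewrite -[RHS]/D; field; exact/andP.
Qed.

(** Differentiability of [g] is a conclusion: the limit of the quotients exists by the Cauchy
    argument, and is the next derivative. The limit functional thus agrees with [dsite g], which
    carries the bound one order further. *)
Lemma form_bound_step n r k g C : 0 <= C -> smooth_kernel n k -> (r < n)%N ->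
  form_bound (fun t => (size t.1 <= r)%N) (dsite g) k C ->
  (forall w i y, (size w <= r)%N ->
     is_derive y (delta_mx 0 i) (dword w g) (dword (i :: w) g y)) /\
  form_bound (fun t => (size t.1 <= r.+1)%N) (dsite g) k C.
Proof.
move=> C0 sk rn GB.
have tauS t h : (size t.1 <= r.+1)%N -> forall a, a \in quotient_site t h ->
    (size a.2.1 <= r)%N.
  case: t => [[|i w] y] /= tr a; rewrite /quotient_site /= !inE.
    by move=> /eqP ->.
  by move=> /orP[] /eqP ->.
have tau_lim t t' : (size t.1 <= r.+1)%N -> (size t'.1 <= r.+1)%N ->
  forall e : R, 0 < e -> exists2 r : R, 0 < r & forall h h', h != 0 -> h' != 0 ->
    `|h| < r -> `|h'| < r ->
    `|bil k (quotient_site t h) (quotient_site t' h') - k t t'| < e.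
  by move=> tr tr'; apply: quotient_site_lim sk _ _; exact: leq_trans rn.
have cv := limit_functional_cvg C0 GB tauS tau_lim.
have bd := limit_functional_bound C0 GB tauS tau_lim.
have D w i y : (size w <= r)%N -> is_derive y (delta_mx 0 i) (dword w g)
    (lim (app (dsite g) (quotient_site (i :: w, y) h) @[h --> (0 : R)^'])).
  move=> wr; apply/is_derive_cvg.
  have -> : (fun h : R => h^-1 * (dword w g (y + h *: delta_mx 0 i) - dword w g y))
      = (fun h => app (dsite g) (quotient_site (i :: w, y) h)).
    apply/funext => h; rewrite /quotient_site /app /= !big_cons big_nil addr0 /dsite /=.
    by rewrite mulNr mulrBr.
  exact: (cv (i :: w, y)).
have E t : (size t.1 <= r.+1)%N ->
    lim (app (dsite g) (quotient_site t h) @[h --> (0 : R)^']) = dsite g t.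
  case: t => [[|i w] y] /= tr.
    rewrite (_ : (fun h : R => _) = cst (dsite g ([::], y))); first exact: lim_cst.
    by apply/funext => h; rewrite /quotient_site /app /= big_cons big_nil addr0 mul1r.
  have := D w i y tr => h.
  by rewrite -(@derive_val _ _ _ _ _ _ _ h).
split=> [w i y wr|L SL].
  by have := D w i y wr; rewrite E.
by have := bd L SL; rewrite (eq_app (G' := dsite g)) // => a /SL /E.
Qed.

Lemma form_bound_smooth n k g C : 0 <= C -> smooth_kernel n k ->
  form_bound (fun t => (size t.1 <= 0)%N) (dsite g) k C ->
  (forall w i y, (size w < n)%N ->
     is_derive y (delta_mx 0 i) (dword w g) (dword (i :: w) g y)) /\
  form_bound (fun t => (size t.1 <= n)%N) (dsite g) k C.
Proof.
move=> C0 sk B0.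
have main r : (r <= n)%N -> (forall w i y, (size w < r)%N ->
     is_derive y (delta_mx 0 i) (dword w g) (dword (i :: w) g y)) /\
  form_bound (fun t => (size t.1 <= r)%N) (dsite g) k C.
  elim: r => [|r IH] rn; first by split.
  have [_ Br] := IH (ltnW rn).
  by have [D B] := form_bound_step C0 sk rn Br; split.
exact: main.
Qed.

End NativeDerivatives.

(** * Functionals annihilating finitely many polynomials *)

Section ConditionalKernels.
Context {R : realType} {d : nat}.

Notation site := (seq 'I_d * 'rV[R]_d)%type.
Implicit Types (t : site) (L : seq (R * site)) (g : 'rV[R]_d -> R).
Implicit Types (p q : mpoly d R).

(** The form of [k] between [t - lf t * xi] and [t' - lf t' * xi], read as formal combinations of
    sites. *)
Definition corrected_kernel (k : site -> site -> R) (lf : site -> R) (xi : site) :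
    site -> site -> R :=
  fun t t' => k t t' - lf t * k xi t' - k t xi * lf t' + lf t * lf t' * k xi xi.

Lemma bil_corrected k lf xi L : bil (corrected_kernel k lf xi) L L =
  bil k L L - app lf L * app (k xi) L - app (k^~ xi) L * app lf L
    + app lf L * app lf L * k xi xi.
Proof.
rewrite bilE.
have E t : app (corrected_kernel k lf xi t) L =
    app (k t) L + (- app (k xi) L) * lf t + (- app lf L) * k t xi
    + (app lf L * k xi xi) * lf t.
  rewrite /corrected_kernel.
  rewrite (_ : (fun t' => _) = (fun t' => (k t t' + (- lf t) * k xi t' + (- k t xi) * lf t')
    + (lf t * k xi xi) * lf t')); last by apply/funext => t'; ring.
  rewrite !appD !appZ; ring.
under [X in app X _]eq_fun do rewrite E.
by rewrite !appD !appZ -bilE; ring.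
Qed.

Lemma bil_cons_corrected k lf xi L :
  bil k ((- app lf L, xi) :: L) ((- app lf L, xi) :: L) =
  bil (corrected_kernel k lf xi) L L.
Proof.
rewrite bil_corrected bilE app_cons /=.
under [X in _ + app X _]eq_fun do rewrite app_cons /=.
by rewrite app_cons /= appD appZ -bilE; ring.
Qed.

Lemma dsite_peval_derive p t i (h : R) :
  is_derive h 1 (fun s : R => dsite (peval p) (shift_site t (delta_mx 0 i) s))
    (dsite (peval p) (cons_site i (shift_site t (delta_mx 0 i) h))).
Proof.
apply/is_derive_line; apply: partial_derive.
by apply: dword_Cr; exact: Cr_peval.
Qed.

Lemma dsite_peval_cvg p t u (U : Type) (F : set_system U) {FF : Filter F} (f : U -> R) :
  f x @[x --> F] --> (0 : R) ->
  dsite (peval p) (shift_site t u (f x)) @[x --> F] --> dsite (peval p) t.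
Proof.
move=> f0; rewrite /dsite /shift_site /=.
have c : continuous (dword t.1 (peval p)).
  by rewrite dword_peval; exact: peval_continuous.
have l : t.2 + f x *: u @[x --> F] --> t.2.
  have := cvgD (cvg_cst t.2) (cvgZr_tmp (a := u) f0).
  by rewrite scale0r addr0; apply.
exact: (cvg_comp _ _ l (c _)).
Qed.

Lemma corrected_smooth n k p (xi : 'rV[R]_d) : smooth_kernel n k ->
  smooth_kernel n (corrected_kernel k (dsite (peval p)) ([::], xi)).
Proof.
move=> [K1 K2 K3]; set lf := dsite (peval p); split.
- move=> t t' i h tn tn'.
  have d1 := K1 t t' i h tn tn'.
  have d2 := dsite_peval_derive p t i h.
  have d3 := K1 t ([::], xi) i h tn (leq0n _).
  have e2 := is_deriveZ_fun (- k ([::], xi) t' + lf t' * k ([::], xi) ([::], xi)) d2.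
  have e3 := is_deriveZ_fun (- lf t') d3.
  have := is_deriveD_fun (is_deriveD_fun d1 e2) e3.
  rewrite (_ : (fun s => _) = fun s => corrected_kernel k lf ([::], xi)
      (shift_site t (delta_mx 0 i) s) t'); last first.
    by apply/funext => s; rewrite /corrected_kernel /lf; ring.
  move=> D; apply: (is_derive_eq D).
  by rewrite /corrected_kernel /lf; ring.
- move=> t t' i h tn tn'.
  have d1 := K2 t t' i h tn tn'.
  have d2 := dsite_peval_derive p t' i h.
  have d3 := K2 ([::], xi) t' i h (leq0n _) tn'.
  have e2 := is_deriveZ_fun (- k t ([::], xi) + lf t * k ([::], xi) ([::], xi)) d2.
  have e3 := is_deriveZ_fun (- lf t) d3.
  have := is_deriveD_fun (is_deriveD_fun d1 e2) e3.
  rewrite (_ : (fun s => _) = fun s => corrected_kernel k lf ([::], xi)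
      t (shift_site t' (delta_mx 0 i) s)); last first.
    by apply/funext => s; rewrite /corrected_kernel /lf; ring.
  move=> D; apply: (is_derive_eq D).
  by rewrite /corrected_kernel /lf; ring.
move=> t t' u u' tn tn'; rewrite /corrected_kernel.
have l1 : lf (shift_site t u p.1) @[p --> ((0 : R), (0 : R))] --> lf t.
  by apply: dsite_peval_cvg; exact: cvg_fst.
have l2 : lf (shift_site t' u' p.2) @[p --> ((0 : R), (0 : R))] --> lf t'.
  by apply: dsite_peval_cvg; exact: cvg_snd.
have k1 : k ([::], xi) (shift_site t' u' p.2) @[p --> ((0 : R), (0 : R))]
    --> k ([::], xi) t'.
  have := K3 ([::], xi) t' 0 u' (leq0n _) tn'.
  by under eq_fun do rewrite shift_site_dir0.
have k2 : k (shift_site t u p.1) ([::], xi) @[p --> ((0 : R), (0 : R))]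
    --> k t ([::], xi).
  have := K3 t ([::], xi) u 0 tn (leq0n _).
  by under eq_fun do rewrite shift_site_dir0.
exact: (cvgD (cvgB (cvgB (K3 t t' u u' tn tn') (cvgM l1 k1)) (cvgM k2 l2))
  (cvgM (cvgM l1 l2) (cvg_cst (k ([::], xi) ([::], xi))))).
Qed.

Lemma dsite_pevalB p q (c : R) t : (dsite (peval (p - c *: q)) t =
  dsite (peval p) t - c * dsite (peval q) t).
Proof.
rewrite /dsite !dword_peval.
have -> : foldr (@mderiv d R) (p - c *: q) t.1 =
    foldr (@mderiv d R) p t.1 - c *: foldr (@mderiv d R) q t.1.
  by elim: (t.1) => //= i w ->; rewrite mderivB mderivZ.
by rewrite -scaleNr pevalD /= pevalZ mulNr.
Qed.

(** [partial] is defined for every function, so its additivity requires existing derivatives. At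
    each order the derivative of [g - c p] exists by hypothesis, hence that of [g], which gives the
    formula one order higher. *)
Lemma dsiteB_peval n g p c : (forall w i y, (size w < n)%N ->
    is_derive y (delta_mx 0 i) (dword w (fun x => g x - c * peval p x))
      (dword (i :: w) (fun x => g x - c * peval p x) y)) ->
  (forall w, (size w <= n)%N -> forall y,
    dword w g y = dword w (fun x => g x - c * peval p x) y + c * dword w (peval p) y) /\
  (forall w i y, (size w < n)%N ->
    is_derive y (delta_mx 0 i) (dword w g) (dword (i :: w) g y)).
Proof.
set g1 := (fun x => _) => D1.
have step w i y : (size w < n)%N ->
    (forall y, dword w g y = dword w g1 y + c * dword w (peval p) y) ->
    is_derive y (delta_mx 0 i) (dword w g)
      (dword (i :: w) g1 y + c * dword (i :: w) (peval p) y).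
  move=> wn E; rewrite (_ : dword w g = dword w g1 + c *: dword w (peval p)); last first.
    by apply/funext => y'; rewrite E.
  apply: is_deriveD; first exact: D1.
  apply: is_deriveZ; apply: partial_derive.
  by apply: dword_Cr; exact: Cr_peval.
have E w : (size w <= n)%N -> forall y,
    dword w g y = dword w g1 y + c * dword w (peval p) y.
  elim: w => [|i w IH] wn y; first by rewrite /= /g1 subrK.
  have := step w i y wn (IH (ltnW wn)) => h.
  exact: (@derive_val _ _ _ _ _ _ _ h).
split=> // w i y wn; have := step w i y wn (E w (ltnW wn)).
by rewrite -E.
Qed.

(** Induction on the number of side conditions; the kernel, the function and the other polynomials
    are all replaced at each step, hence generalized. *)
Lemma native_smooth n C (ps : seq (mpoly d R)) k g : 0 <= C -> smooth_kernel n k ->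
  (forall L, (forall a, a \in L -> size a.2.1 <= 0)%N ->
     (forall p, p \in ps -> app (dsite (peval p)) L = 0) ->
     `|app (dsite g) L| <= C * Num.sqrt (bil k L L)) ->
  (forall w i y, (size w < n)%N ->
     is_derive y (delta_mx 0 i) (dword w g) (dword (i :: w) g y)) /\
  (forall L, (forall a, a \in L -> size a.2.1 <= n)%N ->
     (forall p, p \in ps -> app (dsite (peval p)) L = 0) ->
     `|app (dsite g) L| <= C * Num.sqrt (bil k L L)).
Proof.
move=> C0; move: {2}(size ps) (erefl (size ps)) => m.
elim: m ps k g => [|m IH] [|p0 ps] // k g.
  move=> _ sk GB.
  have [|D B] := form_bound_smooth (g := g) C0 sk.
    by move=> L SL; apply: GB.
  by split=> // L SL _; exact: B.
move=> [psm] sk GB.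
(* A polynomial that vanishes everywhere imposes no condition and is dropped. *)
have [h|h] := pselect (exists xi, peval p0 xi != 0); last first.
  have p00 t : dsite (peval p0) t = 0.
    have z : peval p0 = fun x => 0 * peval p0 x.
      apply/funext => x; rewrite mul0r; apply/eqP/negPn/negP => hx.
      by apply: h; exists x.
    rewrite /dsite z dwordZ; last exact: Cr_peval.
    by rewrite mul0r.
  have a0 L : app (dsite (peval p0)) L = 0.
    by rewrite /app big1 // => a _; rewrite p00 mulr0.
  have [|D B] := IH ps k g psm sk.
    move=> L SL psL; apply: GB => // p; rewrite in_cons => /orP[/eqP -> //|].
    exact: psL.
  split=> // L SL psL; apply: B => // p pps; apply: psL.
  by rewrite in_cons pps orbT.
case: h => xi p0xi.
pose l := (peval p0 xi)^-1 *: p0.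
pose lf := dsite (peval l).
have lfE L : app lf L = (peval p0 xi)^-1 * app (dsite (peval p0)) L.
  rewrite -appZ; apply: eq_app => a _; rewrite /lf /dsite !dword_peval.
  have -> : foldr (@mderiv d R) l a.2.1 =
      (peval p0 xi)^-1 *: foldr (@mderiv d R) p0 a.2.1.
    by elim: (a.2.1) => //= i w ->; rewrite mderivZ.
  by rewrite pevalZ.
pose x0 : site := ([::], xi).
pose k1 := corrected_kernel k lf x0.
pose g1 x := g x - g xi * peval l x.
pose ps1 := [seq q - peval q xi *: l | q <- ps].
have ps1E q L : app (dsite (peval (q - peval q xi *: l))) L =
    app (dsite (peval q)) L - peval q xi * app lf L.
  rewrite -[- (_ * _)]mulNr -appZ -appD; apply: eq_app => a _.
  by rewrite dsite_pevalB mulNr.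
have [||| D1 B1] := IH ps1 k1 g1.
- by rewrite size_map.
- exact: corrected_smooth.
(* [L1] is the projection of [L]. As [l] takes the value 1 at [xi], it annihilates [p0]; it
   annihilates [ps] because [L] annihilates [ps1]; and its form under [k] is that of [L] under
   [k1]. *)
- move=> L SL psL; pose L1 := (- app lf L, x0) :: L.
  have -> : app (dsite g1) L = app (dsite g) L1.
    have -> : app (dsite g1) L = app (fun t => dsite g t + (- g xi) * lf t) L.
      apply: eq_app => a /SL; rewrite leqn0 => /nilP; case: a => c [w y] /= ->.
      by rewrite /dsite /= mulNr.
    by rewrite appD appZ app_cons /= /dsite /=; ring.
  rewrite -bil_cons_corrected; apply: GB.
    by move=> a; rewrite in_cons => /orP[/eqP ->//|]; exact: SL.
  move=> p; rewrite in_cons app_cons /= {1}/dsite /= => /orP[/eqP ->|pps].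
    by rewrite lfE mulrC mulrN mulrA mulfV // mul1r addNr.
  have := psL (p - peval p xi *: l) (map_f _ pps).
  by rewrite ps1E => <-; ring.
have [E D] := dsiteB_peval D1.
split=> // L SL psL.
(* On functionals that already annihilate [p0] the projection is the identity, so corrected and
   original data agree. *)
have lf0 : app lf L = 0 by rewrite lfE psL ?mem_head // mulr0.
have -> : app (dsite g) L = app (dsite g1) L.
  have -> : app (dsite g) L = app (fun t => dsite g1 t + g xi * lf t) L.
    by apply: eq_app => a aL; rewrite /dsite E //; exact: SL.
  by rewrite appD appZ lf0 mulr0 addr0.
have := B1 L SL; rewrite bil_corrected lf0 !mul0r mulr0 !subr0 addr0; apply.
move=> _ /mapP[q qps ->]; rewrite ps1E lf0 mulr0 subr0; apply: psL.
by rewrite in_cons qps orbT.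
Qed.

End ConditionalKernels.

(** * Translation-invariant kernels *)

Section TranslationKernel.
Context {R : realType} {d : nat} (n : nat) (Phi : 'rV[R]_d -> R).

Notation site := (seq 'I_d * 'rV[R]_d)%type.
Implicit Types (t : site).

Hypothesis Phi_Cr : Cr (2 * n) Phi.
Hypothesis Phi_even : forall x, Phi (- x) = Phi x.

(** The derivatives of [Phi (y - y')]: each one taken in [y'] contributes a sign. *)
Definition dkernel t t' : R :=
  (-1) ^+ size t'.1 * dword (t.1 ++ t'.1) Phi (t.2 - t'.2).

Lemma dkernel_Cr r w w' : (size w + size w' + r <= 2 * n)%N ->
  Cr r (dword (w ++ w') Phi).
Proof. by move=> h; apply: dword_Cr; apply: (Cr_le _ Phi_Cr); rewrite size_cat. Qed.

Lemma dkernel_derivel t t' u (h : R) : (size t.1 < n)%N -> (size t'.1 <= n)%N ->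
  is_derive h 1 (fun s : R => dkernel (shift_site t u s) t')
    (\sum_j u 0 j * dkernel (cons_site j (shift_site t u h)) t').
Proof.
move=> tn tn'; rewrite /dkernel /=.
have [|_ [D _]] := @dkernel_Cr 1 t.1 t'.1; first lia.
have := D (t.2 - t'.2 + h *: u) u => /is_derive_line D1.
have := is_deriveZ_fun ((-1) ^+ size t'.1) D1.
under eq_fun do rewrite addrAC.
move=> {}D; apply: (is_derive_eq D); rewrite mulr_sumr.
by apply: eq_bigr => j _; rewrite mulrCA addrAC.
Qed.

(** Evenness of [Phi] yields the sign of the total order, which exchanges the sign of one variable
    for that of the other; the words are swapped by [dword_perm]. *)
Lemma dkernel_sym t t' : (size t.1 <= n)%N -> (size t'.1 <= n)%N ->
  dkernel t t' = dkernel t' t.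
Proof.
move=> tn tn'; rewrite /dkernel -opprB dword_even //; last first.
  by apply: (Cr_le _ Phi_Cr); rewrite size_cat; lia.
rewrite (@dword_perm _ _ (t.1 ++ t'.1) (t'.1 ++ t.1)); last 2 first.
- by apply: (Cr_le _ Phi_Cr); rewrite size_cat; lia.
- by rewrite perm_catC.
by rewrite mulrA size_cat -exprD addnCA addnn -mul2n exprD exprM sqrrN expr1n
  expr1n mulr1.
Qed.

Lemma dkernel_deriver t t' u (h : R) : (size t.1 <= n)%N -> (size t'.1 < n)%N ->
  is_derive h 1 (fun s : R => dkernel t (shift_site t' u s))
    (\sum_j u 0 j * dkernel t (cons_site j (shift_site t' u h))).
Proof.
move=> tn tn'.
have E s : dkernel t (shift_site t' u s) = dkernel (shift_site t' u s) t.
  by apply: dkernel_sym => //; exact: ltnW.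
under eq_fun do rewrite E.
rewrite (eq_bigr (fun j => u 0 j * dkernel (cons_site j (shift_site t' u h)) t)).
  exact: dkernel_derivel.
by move=> j _; rewrite dkernel_sym.
Qed.

Lemma sum_delta_mx (i : 'I_d) (f : 'I_d -> R) :
  \sum_j (delta_mx 0 i : 'rV[R]_d) 0 j * f j = f i.
Proof.
rewrite (bigD1 i) //= mxE !eqxx mul1r big1 ?addr0 // => j ji.
by rewrite mxE (negbTE ji) andbF mul0r.
Qed.

Lemma dkernel_smooth : smooth_kernel n dkernel.
Proof.
split.
- move=> t t' i h tn tn'.
  by have := dkernel_derivel (delta_mx 0 i) h tn tn'; rewrite sum_delta_mx.
- move=> t t' i h tn tn'.
  by have := dkernel_deriver (delta_mx 0 i) h tn tn'; rewrite sum_delta_mx.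
move=> t t' u u' tn tn'; rewrite /dkernel /=.
have l : t.2 + p.1 *: u - (t'.2 + p.2 *: u') @[p --> ((0 : R), (0 : R))]
    --> t.2 + (0 : R) *: u - (t'.2 + (0 : R) *: u').
  apply: cvgB; (apply: cvgD; first exact: cvg_cst); apply: cvgZr_tmp.
  - exact: cvg_fst.
  - exact: cvg_snd.
rewrite !scale0r !addr0 in l.
have [|c _] := @dkernel_Cr 0 t.1 t'.1; first lia.
exact: (cvgM (cvg_cst _) (cvg_comp _ _ l (c _))).
Qed.

Lemma dkernel_perm t w w' y : (size t.1 <= n)%N -> (size w <= n)%N ->
  perm_eq w w' -> dkernel t (w, y) = dkernel t (w', y).
Proof.
move=> tn wn ww'; rewrite /dkernel /= (perm_size ww'); congr (_ * _).
have E : dword (t.1 ++ w) Phi = dword (t.1 ++ w') Phi.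
  apply: dword_perm; last by rewrite perm_cat2l.
  by apply: (Cr_le _ Phi_Cr); rewrite size_cat mul2n -addnn leq_add.
by rewrite E.
Qed.

End TranslationKernel.

(** * Taylor polynomials *)

Section Taylor.
Context {R : realType} {d : nat}.
Implicit Types (S : seq 'I_d -> R) (u z x : 'rV[R]_d) (p q : mpoly d R).

Lemma inPiD s p q : inPi s p -> inPi s q -> inPi s (p + q).
Proof. by move=> hp hq; apply: leq_trans (msizeD_le _ _) _; rewrite geq_max hp. Qed.

Lemma inPiZ s c p : inPi s p -> inPi s (c *: p).
Proof. by move=> hp; apply: leq_trans (msizeZ_le _ _) _. Qed.

Lemma inPi0 s : inPi s (0 : mpoly d R).
Proof. by rewrite /inPi msize0. Qed.

Lemma inPi_sum s (I : Type) (r : seq I) (f : I -> mpoly d R) :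
  (forall i, inPi s (f i)) -> inPi s (\sum_(i <- r) f i).
Proof. by move=> h; apply: big_ind => //; [exact: inPi0|exact: inPiD]. Qed.

Lemma inPi_le s s' p : (s <= s')%N -> inPi s p -> inPi s' p.
Proof. by move=> ss; rewrite /inPi => /leq_trans; apply. Qed.

Lemma inPiC s c : inPi s.+1 (mpolyC d c : mpoly d R).
Proof. by rewrite /inPi msizeC; case: eqP. Qed.

Lemma inPiMX s j c p : inPi s p -> inPi s.+1 ((mpolyX R (mnm1 j) - mpolyC d c) * p).
Proof.
rewrite /inPi => hp; set q := _ - _.
have [->|q0] := eqVneq q 0; first by rewrite mul0r msize0.
have [->|p0] := eqVneq p 0; first by rewrite mulr0 msize0.
rewrite msizeM //.
have q2 : (msize q <= 2)%N.
  apply: inPiD; first by rewrite /inPi msizeX mdeg1.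
  by rewrite -mpolyCN; apply: (@inPi_le 1); rewrite ?inPiC //; exact: inPiC.
move: hp q2; move: (msize q) (msize p) => A B; lia.
Qed.

(** If [S] tabulates the derivatives of a function by words, this is its [a]-th derivative in
    direction [u]. *)
Fixpoint dirw u a S : R :=
  if a is a'.+1 then \sum_j u 0 j * dirw u a' (fun w => S (j :: w)) else S [::].

Lemma eq_dirw u a S S' : (forall w, size w = a -> S w = S' w) ->
  dirw u a S = dirw u a S'.
Proof.
elim: a S S' => [|a IH] S S' h /=; first exact: h.
by apply: eq_bigr => j _; congr (_ * _); apply: IH => w wa; rewrite h //= wa.
Qed.

Lemma dirwD u a S S' : dirw u a (fun w => S w + S' w) = dirw u a S + dirw u a S'.
Proof.
elim: a S S' => [|a IH] S S' //=.
by rewrite -big_split; apply: eq_bigr => j _; rewrite IH mulrDr.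
Qed.

Lemma dirwZ u a c S : dirw u a (fun w => c * S w) = c * dirw u a S.
Proof.
elim: a S => [|a IH] S //=.
by rewrite mulr_sumr; apply: eq_bigr => j _; rewrite IH mulrCA.
Qed.

Lemma dirw_sum (I : Type) (r : seq I) u a (c : I -> R) (Ss : I -> seq 'I_d -> R) :
  dirw u a (fun w => \sum_(i <- r) c i * Ss i w) = \sum_(i <- r) c i * dirw u a (Ss i).
Proof.
elim: r => [|i r IH].
  rewrite big_nil (@eq_dirw u a _ (fun w => 0 * (fun=> 0) w)).
    by rewrite dirwZ mul0r.
  by move=> w _; rewrite big_nil mul0r.
rewrite big_cons -IH -dirwZ -dirwD; apply: eq_dirw => w _.
by rewrite big_cons.
Qed.

Lemma dirw_derive u a (Ss : R -> seq 'I_d -> R) (S' : seq 'I_d -> R) (s : R) :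
  (forall w, size w = a -> is_derive s 1 (Ss^~ w) (S' w)) ->
  is_derive s 1 (fun t => dirw u a (Ss t)) (dirw u a S').
Proof.
elim: a Ss S' => [|a IH] Ss S' h /=; first exact: h.
have D j : is_derive s 1 (fun t => u 0 j * dirw u a (fun w => Ss t (j :: w)))
    (u 0 j * dirw u a (fun w => S' (j :: w))).
  apply: is_deriveZ_fun; apply: IH => w wa.
  by apply: h; rewrite /= wa.
have := is_derive_sum (fun j => D j).
rewrite (_ : \sum_(j < d) _ = fun t => \sum_j u 0 j * dirw u a (fun w => Ss t (j :: w))) //.
by apply/funext => t; rewrite fct_sumE.
Qed.

Lemma dirw_bound u a S B : 0 <= B -> (forall w, size w = a -> `|S w| <= B) ->
  `|dirw u a S| <= (\sum_j `|u 0 j|) ^+ a * B.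
Proof.
move=> B0; elim: a S => [|a IH] S h /=; first by rewrite mul1r h.
apply: (le_trans (ler_norm_sum _ _ _)).
rewrite exprS -mulrA mulr_suml; apply: ler_sum => j _.
by rewrite normrM ler_wpM2l // IH // => w wa; apply: h; rewrite /= wa.
Qed.

(** The degree [a] term of the Taylor expansion at [z] of a function with derivatives [S]. The
    recursion builds up the factorial factor by factor and makes differentiation an induction. *)
Fixpoint tpoly z a S : mpoly d R :=
  if a is a'.+1 then
    a%:R^-1 *: \sum_j (mpolyX R (mnm1 j) - mpolyC d (z 0 j)) *
                      tpoly z a' (fun w => S (j :: w))
  else mpolyC d (S [::]).

Lemma peval_tpoly z a S x : peval (tpoly z a S) x = dirw (x - z) a S / a`!%:R.
Proof.
elim: a S => [|a IH] S /=; first by rewrite /peval mevalC divr1.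
rewrite pevalZ peval_sum factS natrM invfM [RHS]mulrCA; congr (_ * _).
rewrite mulr_suml; apply: eq_bigr => j _.
rewrite pevalM IH mulrA; congr (_ * _ * _).
by rewrite /peval mevalB mevalXU mevalC !mxE.
Qed.

Lemma inPi_tpoly z a S : inPi a.+1 (tpoly z a S).
Proof.
elim: a S => [|a IH] S; first exact: inPiC.
by apply: inPiZ; apply: inPi_sum => j; apply: inPiMX; exact: IH.
Qed.

Definition symw (N : nat) S : Prop :=
  forall w w', (size w <= N)%N -> perm_eq w w' -> S w = S w'.

Lemma symw_cons N S i : symw N.+1 S -> symw N (fun w => S (i :: w)).
Proof. by move=> h w w' wN ww'; apply: h => //; rewrite perm_cons. Qed.

Lemma eq_tpoly z a S S' : (forall w, size w = a -> S w = S' w) ->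
  tpoly z a S = tpoly z a S'.
Proof.
elim: a S S' => [|a IH] S S' h /=; first by rewrite h.
congr (_ *: _); apply: eq_bigr => j _; congr (_ * _).
by apply: IH => w wa; rewrite h //= wa.
Qed.

Lemma mderiv_tpoly z a S i : symw a.+1 S ->
  mderiv i (tpoly z a.+1 S) = tpoly z a (fun w => S (i :: w)).
Proof.
elim: a S => [|a IH] S symS.
  rewrite /= invr1 scale1r raddf_sum /= (bigD1 i) //= big1 ?addr0 => [|j ji].
    rewrite mderivM mderivC mulr0 addr0 mderivB mderivC subr0 mderivX mnm1E eqxx scale1r.
    have -> : mnm_sub (mnm1 i) (mnm1 i) = mnm0 by rewrite -{1}[mnm1 i]add0m addmK.
    by rewrite mpolyX0 mul1r.
  rewrite mderivM mderivC mulr0 addr0 mderivB mderivC subr0 mderivX mnm1E (negbTE ji).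
  by rewrite scale0r mul0r.
pose P j : mpoly d R := mpolyX R (mnm1 j) - mpolyC d (z 0 j).
have tpE b S' : tpoly z b.+1 S' =
    b.+1%:R^-1 *: \sum_j P j * tpoly z b (fun w => S' (j :: w)) by [].
rewrite tpE mderivZ.
have dP j : mderiv i (P j) = (j == i)%:R *: 1.
  rewrite /P mderivB mderivC subr0 mderivX mnm1E.
  have [->|ji] := eqVneq j i; last by rewrite !scale0r.
  have -> : mnm_sub (mnm1 i) (mnm1 i) = mnm0 by rewrite -{1}[mnm1 i]add0m addmK.
  by rewrite mpolyX0.
have sumT (T : 'I_d -> mpoly d R) : \sum_j (j == i)%:R *: T j = T i.
  rewrite (bigD1 i) //= eqxx scale1r big1 ?addr0 // => j /negbTE ->.
  by rewrite scale0r.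
have D j : mderiv i (P j * tpoly z a.+1 (fun w => S (j :: w))) =
    (j == i)%:R *: tpoly z a.+1 (fun w => S (j :: w))
    + P j * tpoly z a (fun w => S (i :: j :: w)).
  rewrite mderivM dP -scalerAl mul1r; congr (_ + _).
  rewrite IH; last exact: symw_cons.
  congr (_ * _); apply: eq_tpoly => w wa; apply: symS; first by rewrite /= wa.
  by rewrite -[_ :: _ :: w]/([:: j; i] ++ w) -[X in perm_eq _ X]/([:: i; j] ++ w)
    perm_cat2r (perm_catC [:: j] [:: i]).
have -> : mderiv i (\sum_j P j * tpoly z a.+1 (fun w => S (j :: w))) =
    \sum_j ((j == i)%:R *: tpoly z a.+1 (fun w => S (j :: w))
    + P j * tpoly z a (fun w => S (i :: j :: w))).
  by rewrite raddf_sum; apply: eq_bigr => j _; exact: D.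
have -> : \sum_j ((j == i)%:R *: tpoly z a.+1 (fun w => S (j :: w))
    + P j * tpoly z a (fun w => S (i :: j :: w)))
  = tpoly z a.+1 (fun w => S (i :: w))
    + \sum_j P j * tpoly z a (fun w => S (i :: j :: w)).
  rewrite big_split; congr (_ + _).
  exact: (sumT (fun j => tpoly z a.+1 (fun w => S (j :: w)))).
(* By the recursion [Q] is [a.+1] times the claimed polynomial; together with the term from the
   linear factor this makes [a.+2], which cancels the prefactor. *)
rewrite tpE; set Q := \sum_j _.
have QE : Q = a.+1%:R *: (a.+1%:R^-1 *: Q).
  by rewrite scalerA mulfV ?scale1r // pnatr_eq0.
rewrite {2}QE; set Q' := _^-1 *: Q.
by rewrite -{1}[Q']scale1r -scalerDl scalerA nat1r mulVf ?scale1r //.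
Qed.

Lemma foldr_mderiv_tpoly z a S w : (size w <= a)%N -> symw a S ->
  foldr (@mderiv d R) (tpoly z a S) w =
  tpoly z (a - size w) (fun v => S (w ++ v)).
Proof.
elim: w => [|i w IH] wa symS; first by rewrite subn0.
rewrite /= IH //; last exact: ltnW.
have E : (a - size w)%N = (a - (size w).+1).+1 by move: wa => /=; lia.
rewrite E mderiv_tpoly.
  apply: eq_tpoly => v va; apply: symS.
    by move: wa; rewrite size_cat /= va /=; lia.
  by rewrite perm_catC /= perm_cons perm_catC.
move=> v v' vs vv'; apply: symS; last by rewrite perm_cat2l.
by move: wa vs; rewrite size_cat /=; lia.
Qed.

Lemma dword_tpoly z a S w : symw a S ->
  dword w (peval (tpoly z a S)) z = if size w == a then S w else 0.
Proof.
move=> symS; rewrite dword_peval.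
have [wa|aw] := leqP (size w) a.
  rewrite foldr_mderiv_tpoly // peval_tpoly subrr.
  have [E|ne] := eqVneq (size w) a.
    by rewrite E subnn /= cats0 divr1.
  have -> : (a - size w)%N = (a - size w).-1.+1 by lia.
  by rewrite /= big1 ?mul0r // => j _; rewrite mxE mul0r.
rewrite (gtn_eqF aw).
have -> : w = take (size w - a.+1) w ++ drop (size w - a.+1) w by rewrite cat_take_drop.
rewrite foldr_cat; set w1 := take _ _; set w2 := drop _ _.
have sw2 : size w2 = a.+1 by rewrite size_drop; lia.
have -> : foldr (@mderiv d R) (tpoly z a S) w2 = 0.
  case: w2 sw2 => //= i w2 [sw2].
  by rewrite foldr_mderiv_tpoly ?sw2 // subnn /= mderivC.
have -> : foldr (@mderiv d R) 0 w1 = 0 by elim: w1 => //= i w1 ->; rewrite mderiv0.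
by rewrite /peval meval0.
Qed.

(** Every symmetric table [S] up to length [n] consists of the derivatives at [z] of a polynomial;
    exactness is applied to that polynomial. *)
Lemma exact_taylor N (n : nat) z (D : mpoly d R -> R) (x : 'I_N -> 'rV[R]_d)
    (w : 'I_N -> R) (I : finType) (c : I -> R) (word : I -> seq 'I_d) S :
  (forall p, D p = \sum_i c i * dword (word i) (peval p) z) ->
  (forall p, inPi n.+1 p -> D p = \sum_j w j * peval p (x j)) ->
  (forall i, (size (word i) <= n)%N) -> symw n S ->
  \sum_i c i * S (word i) =
  \sum_j w j * \sum_(a < n.+1) dirw (x j - z) a S / a`!%:R.
Proof.
move=> DE Dx wn symS; pose p := \sum_(a < n.+1) tpoly z a S.
have pn : inPi n.+1 p.
  by apply: inPi_sum => a; apply: inPi_le (inPi_tpoly z a S).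
have := Dx p pn; rewrite DE => E.
transitivity (\sum_j w j * peval p (x j)).
  rewrite -E; apply: eq_bigr => i _; congr (_ * _).
  rewrite dword_peval (_ : foldr _ p _ =
    \sum_(a < n.+1) foldr (@mderiv d R) (tpoly z a S) (word i)); last first.
    by elim: (word i) => //= j v ->; rewrite raddf_sum.
  rewrite peval_sum.
  rewrite (bigD1 (Ordinal (wn i : (size (word i) < n.+1)%N))) //= big1 ?addr0.
    rewrite -dword_peval dword_tpoly ?eqxx // => v v' vs; apply: symS.
    exact: leq_trans (wn i).
  move=> a ai; rewrite -dword_peval dword_tpoly.
    by case: eqP => // h; case/eqP: ai; apply: val_inj.
  by move=> v v' vs; apply: symS; apply: leq_trans vs _; rewrite -ltnS.
apply: eq_bigr => j _; congr (_ * _); rewrite peval_sum.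
by apply: eq_bigr => a _; rewrite peval_tpoly.
Qed.

End Taylor.

(** * Taylor remainders *)

Section Jets.
Context {R : realType}.

Lemma halfpow_derive m (s : R) : 0 < s ->
  is_derive s 1 (fun t : R => t ^+ m.+1 * Num.sqrt t)
    ((m.+1%:R + 2^-1) * (s ^+ m * Num.sqrt s)).
Proof.
move=> s0.
have D1 : is_derive s 1 (fun t : R => t ^+ m.+1) (m.+1%:R * s ^+ m).
  have := is_deriveX m.+1 (is_derive_id s (1 : R)).
  rewrite (_ : id ^+ _ = fun s : R => s ^+ m.+1).
    by rewrite /GRing.scale /= mulr1.
  by apply/funext => t; rewrite fctE.
have D := is_deriveM D1 (is_derive1_sqrt s0).
apply: (is_derive_eq D); rewrite /GRing.scale /=.
have q0 : Num.sqrt s != 0 by rewrite gt_eqF // sqrtr_gt0.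
have E : s = Num.sqrt s * Num.sqrt s by rewrite -expr2 sqr_sqrtr // ltW.
rewrite exprS {1}E; field.
by rewrite q0.
Qed.

Lemma halfpow_continuous m : continuous (fun t : R => t ^+ m * Num.sqrt t).
Proof. by move=> t; apply: cvgM; [exact: exprn_continuous|exact: sqrt_continuous]. Qed.

(** The comparison function is an antiderivative, [s ^+ m.+1 * Num.sqrt s] divided by [m.+1 + 1/2]:
    the origin of the factors in the constant. As the derivative of [Num.sqrt] at 0 is lacking, the
    mean value theorem is used with derivatives on the open interval. *)
Lemma le_of_derive (f df : R -> R) (m : nat) (B : R) : f 0 = 0 ->
  (forall s : R, is_derive s 1 f (df s)) ->
  (forall s, 0 < s <= 1 -> df s <= B * (s ^+ m * Num.sqrt s)) ->
  forall s, 0 <= s <= 1 -> f s <= B / (m.+1%:R + 2^-1) * (s ^+ m.+1 * Num.sqrt s).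
Proof.
move=> f0 Df hdf s /andP[s0 s1].
pose c := B / (m.+1%:R + 2^-1).
pose F (t : R) := c * (t ^+ m.+1 * Num.sqrt t) + (-1) * f t.
have c0 : m.+1%:R + 2^-1 != 0 :> R by rewrite gt_eqF // ltr_wpDl.
have DF (t : R) : 0 < t ->
    is_derive t 1 F (B * (t ^+ m * Num.sqrt t) + (-1) * df t).
  move=> t0; have := is_deriveD_fun (is_deriveZ_fun c (halfpow_derive m t0))
    (is_deriveZ_fun (-1) (Df t)).
  move=> D; apply: (is_derive_eq D); congr (_ + _).
  by rewrite /c [LHS]mulrA divfK.
have cF : continuous F.
  move=> t.
  have c1 : {for t, continuous (fun t : R => c * (t ^+ m.+1 * Num.sqrt t))}.
    by apply: continuousZ_for; exact: halfpow_continuous.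
  have c2 : {for t, continuous (fun t : R => (-1) * f t)}.
    by apply: continuousZ_for; exact: (is_derive_continuous Df).
  exact: (cvgD c1 c2).
have [s_eq0|s_neq0] := eqVneq s 0.
  by rewrite s_eq0 f0 exprS !mul0r mulr0.
have s_gt0 : 0 < s by rewrite lt_neqAle eq_sym s_neq0.
have DF' t : t \in `]0, s[ -> is_derive t 1 F
    (B * (t ^+ m * Num.sqrt t) + (-1) * df t).
  by rewrite in_itv /= => /andP[t0 _]; exact: DF.
have [t] := MVT s_gt0 DF' (continuous_subspaceT cF).
rewrite in_itv /= subr0 => /andP[t0 ts] E.
have : 0 <= F s - F 0.
  rewrite E; apply: mulr_ge0; last exact: ltW.
  rewrite mulN1r subr_ge0 hdf // t0 /=.
  by apply: ltW; exact: (lt_le_trans ts s1).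
by rewrite /F f0 expr0n /= mul0r !mulr0 addr0 subr0 mulN1r subr_ge0.
Qed.

Lemma le_norm_of_derive (f df : R -> R) (m : nat) (B : R) : f 0 = 0 ->
  (forall s : R, is_derive s 1 f (df s)) ->
  (forall s, 0 < s <= 1 -> `|df s| <= B * (s ^+ m * Num.sqrt s)) ->
  forall s, 0 <= s <= 1 -> `|f s| <= B / (m.+1%:R + 2^-1) * (s ^+ m.+1 * Num.sqrt s).
Proof.
move=> f0 Df hdf s s01; rewrite ler_norml; apply/andP; split; last first.
  apply: (le_of_derive f0 Df) => // t t01.
  by apply: le_trans (hdf t t01); exact: ler_norm.
rewrite lerNl -[leLHS]mulN1r.
apply: (@le_of_derive (fun t => -1 * f t) (fun t => -1 * df t)) => //.
- by rewrite f0 mulr0.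
- move=> t t01; rewrite mulN1r; apply: le_trans (hdf t t01).
  by rewrite -normrN ler_norm.
Qed.

(** [h i] plays the role of the [i]-th derivative; with a family, differentiating the remainder is a
    shift of the index. *)
Definition remj (m : nat) (h : nat -> R -> R) (s : R) : R :=
  h 0%N s - \sum_(i < m.+1) s ^+ i / i`!%:R * h i 0.

Lemma remj_derive m h (s : R) : is_derive s 1 (h 0%N) (h 1%N s) ->
  is_derive s 1 (remj m.+1 h) (remj m (fun i => h i.+1) s).
Proof.
move=> D0.
have DX i : is_derive s 1 (fun t : R => (h i.+1 0 / i.+1`!%:R) * t ^+ i.+1)
    (h i.+1 0 / i.+1`!%:R * (i.+1%:R * s ^+ i)).
  apply: is_deriveZ_fun.
  have := is_deriveX i.+1 (is_derive_id s (1 : R)).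
  rewrite (_ : id ^+ _ = fun s : R => s ^+ i.+1).
    by rewrite /GRing.scale /= mulr1.
  by apply/funext => t; rewrite fctE.
have DS := @is_derive_sum _ _ _ m.+1 _ _ _ _ (fun i : 'I_m.+1 => DX i).
have D := is_deriveD_fun (is_deriveD_fun D0 (is_derive_cst (- h 0%N 0) s 1))
  (is_deriveZ_fun (-1) DS).
rewrite (_ : remj m.+1 h = fun t => h 0%N t + cst (- h 0%N 0) t + -1 *
  (\sum_(i < m.+1) (fun t : R => (h i.+1 0 / i.+1`!%:R) * t ^+ i.+1)) t).
  apply: (is_derive_eq D); rewrite /remj addr0 mulN1r; congr (_ - _).
  apply: eq_bigr => i _; rewrite factS natrM; field.
  by rewrite nat1r !pnatr_eq0 -lt0n fact_gt0.
apply/funext => t; rewrite /remj big_ord_recl fct_sumE /= mulN1r opprD addrA.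
rewrite expr0 fact0 divr1 mul1r; congr (_ - _).
by apply: eq_bigr => i _; rewrite /bump /= add1n; ring.
Qed.

(** [m] integrations of the Hölder bound of exponent 1/2 on the increment of the top derivative; the
    [i]-th divides by [1/2 + i]. *)
Lemma remj_bound m h B : (forall i (s : R), (i < m)%N -> is_derive s 1 (h i) (h i.+1 s)) ->
  (forall s, 0 <= s <= 1 -> `|h m s - h m 0| <= B * Num.sqrt s) ->
  forall s, 0 <= s <= 1 ->
    `|remj m h s| <= B / \prod_(1 <= i < m.+1) (2^-1 + i%:R) * (s ^+ m * Num.sqrt s).
Proof.
elim: m h => [|m IH] h Dh hm s s01.
  rewrite big_geq // divr1 mul1r /remj big_ord_recl big_ord0 addr0 fact0 divr1 mul1r.
  exact: hm.
have Dr (t : R) := remj_derive m (Dh 0%N t (ltn0Sn _)).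
have -> : \prod_(1 <= i < m.+2) (2^-1 + i%:R) =
    \prod_(1 <= i < m.+1) (2^-1 + i%:R) * (m.+1%:R + 2^-1) :> R.
  by rewrite big_nat_recr //= [2^-1 + _]addrC.
rewrite invfM [B * _]mulrA.
apply: (@le_norm_of_derive (remj m.+1 h) (remj m (fun i => h i.+1)) m) => //.
  rewrite /remj big_ord_recl /= expr0 fact0 divr1 mul1r opprD addrA subrr add0r.
  by rewrite big1 ?oppr0 // => i _; rewrite exprS !mul0r.
move=> t /andP[t0 t1]; apply: (IH (fun i => h i.+1)).
- by move=> i r im; apply: Dh.
- exact: hm.
- by rewrite ltW.
Qed.

End Jets.

(** * Taylor remainder of the kernel in both variables *)

Section Remainder.
Context {R : realType} {d : nat} (n : nat) (Phi : 'rV[R]_d -> R).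

Notation site := (seq 'I_d * 'rV[R]_d)%type.

Hypothesis Phi_Cr : Cr (2 * n) Phi.
Hypothesis Phi_even : forall x, Phi (- x) = Phi x.

Variables (z : 'rV[R]_d) (B : set 'rV[R]_d) (H : R).
Hypothesis H0 : 0 <= H.
Hypothesis lip : forall w p q, size w = (2 * n)%N -> B p -> B q ->
  `|dword w Phi p - dword w Phi q| <= H * enorm (p - q).

Notation K := (dkernel Phi).

(** [F] is any function on sites, so that the remainder of the kernel can be taken in one variable
    with a derivative frozen in the other. *)
Definition trem (v : 'rV[R]_d) (F : site -> R) : R :=
  F ([::], z + v) - \sum_(b < n.+1) dirw v b (fun w => F (w, z)) / b`!%:R.

Let cn : R := \prod_(1 <= i < n.+1) (2^-1 + i%:R).

Let norm1 (u : 'rV[R]_d) : R := \sum_j `|u 0 j|.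

Lemma tremB v F G : trem v (fun t => F t - G t) = trem v F - trem v G.
Proof.
have E b : dirw v b (fun w => F (w, z) - G (w, z)) =
    dirw v b (fun w => F (w, z)) - dirw v b (fun w => G (w, z)).
  rewrite -[- dirw _ _ _]mulN1r -dirwZ -dirwD.
  by apply: eq_dirw => w _; rewrite mulN1r.
rewrite /trem; under eq_bigr do rewrite E mulrBl.
by rewrite sumrB; ring.
Qed.

Lemma eq_trem v F G : (forall t, (size t.1 <= n)%N -> F t = G t) ->
  trem v F = trem v G.
Proof.
move=> E; rewrite /trem E //; congr (_ - _); apply: eq_bigr => b _.
by congr (_ / _); apply: eq_dirw => w wb; rewrite E //= wb -ltnS.
Qed.

Lemma trem0 F : trem 0 F = 0.
Proof.
rewrite /trem big_ord_recl /= addr0 divr1 big1 ?addr0 ?subrr // => b _.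
by rewrite /= big1 ?mul0r // => j _; rewrite mxE mul0r.
Qed.

Lemma trem_sum v (I : Type) (r : seq I) (c : I -> R) (F : I -> site -> R) :
  trem v (fun t => \sum_(j <- r) c j * F j t) = \sum_(j <- r) c j * trem v (F j).
Proof.
rewrite /trem; under [in RHS]eq_bigr do rewrite mulrBr.
rewrite [RHS]sumrB; congr (_ - _).
under [RHS]eq_bigr do rewrite mulr_sumr.
rewrite exchange_big; apply: eq_bigr => b _.
by rewrite dirw_sum mulr_suml; apply: eq_bigr => j _; rewrite mulrA.
Qed.

Lemma trem_derive v (F : R -> site -> R) (F' : site -> R) (s : R) :
  (forall t, (size t.1 <= n)%N -> is_derive s 1 (F^~ t) (F' t)) ->
  is_derive s 1 (fun r => trem v (F r)) (trem v F').
Proof.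
move=> D; rewrite /trem.
have DS := @is_derive_sum _ _ _ n.+1 _ s 1 _ (fun b : 'I_n.+1 =>
  is_deriveZ_fun (b`!%:R^-1) (@dirw_derive _ _ v b (fun r w => F r (w, z))
    (fun w => F' (w, z)) s (fun w wb => D (w, z) (leq_trans (eq_leq wb) (leq_ord b))))).
have := is_deriveD_fun (D ([::], z + v) (leq0n _)) (is_deriveZ_fun (-1) DS).
rewrite (_ : (fun y => F y ([::], z + v) + _) =
  (fun r => F r ([::], z + v) - \sum_(b < n.+1) dirw v b (fun w => F r (w, z)) / b`!%:R)).
  move=> D'; apply: (is_derive_eq D'); rewrite mulN1r; congr (_ - _).
  by apply: eq_bigr => b _; rewrite mulrC.
apply/funext => r; rewrite fct_sumE mulN1r; congr (_ - _).
by apply: eq_bigr => b _; rewrite mulrC.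
Qed.

(** The geometric mean is a product, so that the two variables can be integrated one after the
    other. *)
Let min_le_sqrt (a b : R) : 0 <= a -> 0 <= b -> Num.min a b <= Num.sqrt (a * b).
Proof.
move=> a0 b0; have m0 : 0 <= Num.min a b by rewrite le_min a0.
rewrite -[leLHS]ger0_norm // -sqrtr_sqr ler_wsqrtr // expr2 ler_pM //.
  by rewrite ge_min lexx.
by rewrite ge_min lexx orbT.
Qed.

(** The four values can be paired along [u] or along [v]; either way two Lipschitz estimates apply,
    hence the minimum and the factor 2. *)
Lemma second_difference_bound w (u v : 'rV[R]_d) : size w = (2 * n)%N ->
  B u -> B (u - v) -> B (- v) -> B 0 ->
  `|dword w Phi (u - v) - dword w Phi (- v) - (dword w Phi u - dword w Phi 0)|
   <= 2 * H * Num.sqrt (enorm u * enorm v).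
Proof.
move=> wn Bu Buv Bv B0.
set P := dword w Phi.
have h1 : `|P (u - v) - P (- v)| <= H * enorm u.
  by have := lip wn Buv Bv; rewrite opprK subrK.
have h2 : `|P u - P 0| <= H * enorm u by have := lip wn Bu B0; rewrite subr0.
have h3 : `|P (u - v) - P u| <= H * enorm v.
  by have := lip wn Buv Bu; rewrite addrAC subrr add0r enormN.
have h4 : `|P (- v) - P 0| <= H * enorm v.
  by have := lip wn Bv B0; rewrite subr0 enormN.
rewrite -mulrA; apply: (@le_trans _ _ (2 * (H * Num.min (enorm u) (enorm v)))).
  have [uv|uv] := leP (enorm u) (enorm v).
    by move: h1 h2; rewrite !ler_norml; lra.
  by move: h3 h4; rewrite !ler_norml; lra.
by rewrite !ler_wpM2l // min_le_sqrt ?enorm_ge0.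
Qed.

Section Pair.
Variables u v : 'rV[R]_d.
Hypothesis Buv : forall s t : R, 0 <= s <= 1 -> 0 <= t <= 1 -> B (s *: u - t *: v).

Let C1 := norm1 v ^+ n * (2 * H) * Num.sqrt (enorm u * enorm v).

(** The increment in [r] of the [n]-th derivative of [G] is a second difference of derivatives of
    order [2 * n]. Its bound provides [Num.sqrt r] for the integration here, and leaves [Num.sqrt s]
    for the first variable. *)
Lemma trem_inner w (s : R) : size w = n -> 0 <= s <= 1 ->
  `|trem v (K (w, z + s *: u)) - trem v (K (w, z))| <= C1 / cn * Num.sqrt s.
Proof.
move=> wn s01; rewrite -tremB; have /andP[s0 s1] := s01.
pose G t := K (w, z + s *: u) t - K (w, z) t.
pose h b (r : R) := dirw v b (fun w' => G (w', z + r *: v)).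
have Dh b (r : R) : (b < n)%N -> is_derive r 1 (h b) (h b.+1 r).
  move=> bn.
  have := @dirw_derive _ _ v b (fun r w' => G (w', z + r *: v))
    (fun w' => \sum_j v 0 j * G (j :: w', z + r *: v)) r.
  rewrite dirw_sum; apply => w' w'b.
  have D t : size t.1 = n -> is_derive r 1 (fun r : R => K t (w', z + r *: v))
      (\sum_j v 0 j * K t (j :: w', z + r *: v)).
    move=> tn; apply: (dkernel_deriver Phi_Cr Phi_even (t' := (w', z))).
      by rewrite tn.
    by rewrite /= w'b.
  have := is_deriveD_fun (D (w, z + s *: u) wn) (is_deriveZ_fun (-1) (D (w, z) wn)).
  rewrite (_ : (fun y => _) = (fun r => G (w', z + r *: v))); last first.
    by apply/funext => y; rewrite /G mulN1r.
  move=> {}D; apply: (is_derive_eq D); rewrite mulN1r -sumrB.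
  by apply: eq_bigr => j _; rewrite /G mulrBr.
have hn r : 0 <= r <= 1 -> `|h n r - h n 0| <= C1 * Num.sqrt s * Num.sqrt r.
  move=> r01; have /andP[r0 r1] := r01; rewrite /h -[- dirw _ _ _]mulN1r -dirwZ -dirwD.
  have -> : C1 * Num.sqrt s * Num.sqrt r = norm1 v ^+ n *
      (2 * H * Num.sqrt (enorm (s *: u) * enorm (r *: v))).
    rewrite !enormZ !ger0_norm // mulrACA sqrtrM ?mulr_ge0 // sqrtrM // /C1; ring.
  apply: dirw_bound => [|w' w'n]; first by rewrite !mulr_ge0 ?sqrtr_ge0.
  rewrite mulN1r scale0r addr0 /G /dkernel /= w'n -!mulrBr normrM normrX normrN1 expr1n mul1r.
  rewrite subrr [z + _ - z]addrC addKr.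
  have -> : z + s *: u - (z + r *: v) = s *: u - r *: v by rewrite opprD addrACA subrr add0r.
  have -> : z - (z + r *: v) = - (r *: v) by rewrite opprD addNKr.
  apply: second_difference_bound.
  - by rewrite size_cat wn w'n mul2n addnn.
  - by have := Buv s01 (t := 0); rewrite scale0r subr0 lexx ler01; apply.
  - exact: Buv.
  - by have := Buv (s := 0) _ r01; rewrite scale0r sub0r lexx ler01; apply.
  - by have := Buv (s := 0) (t := 0); rewrite !scale0r subr0 lexx ler01; apply.
have := remj_bound Dh hn (s := 1); rewrite ler01 lexx sqrtr1 expr1n !mulr1 => /(_ isT).
rewrite (_ : remj n h 1 = trem v G); first by rewrite mulrAC.
rewrite /remj /trem /h scale1r; congr (_ - _).
by apply: eq_bigr => b _; rewrite expr1n mul1r scale0r addr0 mulrC.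
Qed.

(** [trem_inner] is the Hölder condition that [remj_bound] requires in the first variable; each
    variable contributes one [cn]. *)
Lemma trem_trem_bound :
  `|trem u (fun t => trem v (K t))| <=
    2 * H * (norm1 u ^+ n * norm1 v ^+ n) * Num.sqrt (enorm u * enorm v) / cn ^+ 2.
Proof.
pose h a (s : R) := dirw u a (fun w => trem v (K (w, z + s *: u))).
have Dh a (s : R) : (a < n)%N -> is_derive s 1 (h a) (h a.+1 s).
  move=> an.
  have := @dirw_derive _ _ u a (fun s w => trem v (K (w, z + s *: u)))
    (fun w => \sum_j u 0 j * trem v (K (j :: w, z + s *: u))) s.
  rewrite dirw_sum; apply => w wa; rewrite -trem_sum.
  apply: trem_derive => t tn.
  by apply: (dkernel_derivel Phi_Cr (t := (w, z))) => //=; rewrite wa.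
have cn0 : 0 < cn.
  by rewrite /cn; apply: prodr_gt0 => i _; rewrite ltr_wpDr // invr_gt0.
have C10 : 0 <= C1.
  by rewrite !mulr_ge0 ?sqrtr_ge0 // exprn_ge0 // sumr_ge0.
have hn s : 0 <= s <= 1 -> `|h n s - h n 0| <= norm1 u ^+ n * (C1 / cn) * Num.sqrt s.
  move=> s01; rewrite /h -[- dirw _ _ _]mulN1r -dirwZ -dirwD -mulrA.
  apply: dirw_bound => [|w wn].
    by rewrite mulr_ge0 ?sqrtr_ge0 // divr_ge0 // ltW.
  by rewrite mulN1r scale0r addr0; exact: trem_inner.
have := remj_bound Dh hn (s := 1); rewrite ler01 lexx sqrtr1 expr1n !mulr1 => /(_ isT).
rewrite -/cn (_ : remj n h 1 = trem u (fun t => trem v (K t))).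
  rewrite /C1 expr2 invfM => /le_trans; apply.
  by rewrite le_eqVlt; apply/orP; left; apply/eqP; ring.
rewrite /remj /trem /h scale1r; congr (_ - _).
by apply: eq_bigr => b _; rewrite expr1n mul1r scale0r addr0 mulrC.
Qed.

End Pair.
End Remainder.

(** * Geometry of the nodes *)

Section Geometry.
Context {R : realType} {d : nat}.
Implicit Types (u x z : 'rV[R]_d).

(** Cauchy-Schwarz, by summing [|a b| <= (a ^ 2 + b ^ 2) / 2] over all pairs of coordinates. *)
Lemma sum_abs_le u : (\sum_j `|u 0 j|) ^+ 2 <= d%:R * enorm u ^+ 2.
Proof.
rewrite sqr_enorm expr2 mulr_suml.
under eq_bigr do rewrite mulr_sumr.
apply: (@le_trans _ _ (\sum_(i < d) \sum_(j < d)
   (2^-1 * u 0 i ^+ 2 + 2^-1 * u 0 j ^+ 2))).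
  apply: ler_sum => i _; apply: ler_sum => j _.
  rewrite -normrM ler_norml; apply/andP; split.
    have := sqr_ge0 (u 0 i + u 0 j); nra.
  have := sqr_ge0 (u 0 i - u 0 j); nra.
rewrite (eq_bigr (fun i : 'I_d => 2^-1 * u 0 i ^+ 2 *+ d + 2^-1 * \sum_j u 0 j ^+ 2)); last first.
  by move=> i _; rewrite big_split /= sumr_const card_ord mulr_sumr.
rewrite big_split /= sumr_const card_ord sumrMnl -mulr_sumr -mulr_natl.
rewrite -[X in _ + X]mulr_natl; set S := \sum_i _; lra.
Qed.

Lemma sum_abs_expr_le n u (v : 'rV[R]_d) : (\sum_j `|u 0 j|) ^+ n * (\sum_j `|v 0 j|) ^+ n <=
  d%:R ^+ n * (enorm u ^+ n * enorm v ^+ n).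
Proof.
rewrite -!exprMn; apply: lerXn2r; rewrite ?nnegrE.
- by rewrite mulr_ge0 // sumr_ge0.
- by rewrite !mulr_ge0 ?enorm_ge0.
rewrite -(@ler_pXn2r _ 2) ?nnegrE //; last 2 first.
- by rewrite mulr_ge0 // sumr_ge0.
- by rewrite !mulr_ge0 ?enorm_ge0.
rewrite !exprMn [in leRHS]expr2 mulrACA.
rewrite ler_pM ?sqr_ge0 //; exact: sum_abs_le.
Qed.

Lemma powR_half n (r : R) : 0 <= r ->
  r `^ (n%:R + 2^-1) = r ^+ n * Num.sqrt r.
Proof.
move=> r0; rewrite powRD; first by rewrite powR_mulrn // powR12_sqrt.
have h : 0 < n%:R + 2^-1 :> R by rewrite ltr_wpDl.
by rewrite (gt_eqF h).
Qed.

Lemma star_ball_sub N z (x : 'I_N -> 'rV[R]_d) i j (s t : R) :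
  0 <= s <= 1 -> 0 <= t <= 1 ->
  star_ball z x (s *: (x i - z) - t *: (x j - z)).
Proof.
move=> s01 t01; rewrite /star_ball /= /diameter.
have mem l (r : R) : 0 <= r <= 1 -> star_set z x (z + r *: (x l - z)).
  by move=> r01; exists l => //; exists r.
apply: sup_upper_bound; last first.
  exists (z + s *: (x i - z), z + t *: (x j - z)).
    by split => /=; exact: mem.
  by rewrite /= opprD addrACA subrr add0r.
split.
  by exists (enorm ((z + s *: (x i - z)) - (z + s *: (x i - z)))); exists
    (z + s *: (x i - z), z + s *: (x i - z)) => //; split; exact: mem.
(* [sup] is an upper bound only for bounded sets; [4 * b] suffices for the squares by
   [|u - v| ^ 2 <= 2 |u| ^ 2 + 2 |v| ^ 2]. *)
pose b := \sum_l enorm (x l - z) ^+ 2.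
exists (Num.sqrt (4 * b)) => _ [[p q] /= [[i1 _ [s1 s101 <-]] [i2 _ [s2 s201 <-]]] <-].
move: s101 s201; rewrite /= !in_itv /= => /andP[s10 s11] /andP[s20 s21].
rewrite -[leLHS]ger0_norm ?enorm_ge0 // -sqrtr_sqr ler_wsqrtr //.
rewrite opprD addrACA subrr add0r.
set u := x i1 - z; set v := x i2 - z.
have ub l (r : R) : 0 <= r -> r <= 1 -> enorm (r *: (x l - z)) ^+ 2 <= b.
  move=> r0 r1; rewrite enormZ exprMn ger0_norm //.
  apply: (@le_trans _ _ (enorm (x l - z) ^+ 2)).
    by rewrite -[leRHS]mul1r ler_wpM2r ?sqr_ge0 // exprn_ile1.
  rewrite /b (bigD1 l) //= lerDl; apply: sumr_ge0 => l' _; exact: sqr_ge0.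
have h : enorm (s1 *: u - s2 *: v) ^+ 2 <=
    2 * enorm (s1 *: u) ^+ 2 + 2 * enorm (s2 *: v) ^+ 2.
  rewrite !sqr_enorm !mulr_sumr -big_split /=; apply: ler_sum => l _.
  rewrite [(s1 *: u - s2 *: v) 0 l]mxE [(- (s2 *: v)) 0 l]mxE.
  have := sqr_ge0 ((s1 *: u) 0 l + (s2 *: v) 0 l); nra.
by have := ub i1 s1 s10 s11; have := ub i2 s2 s20 s21; rewrite -/u -/v; lra.
Qed.

Lemma holder_lipschitz r (F : 'rV[R]_d -> R) (B : set 'rV[R]_d) (H : R) w p q :
  Cr r F -> holder_seminorm r 1 B F = H%:E -> size w = r -> B p -> B q ->
  `|dword w F p - dword w F q| <= H * enorm (p - q).
Proof.
move=> cF HE wr Bp Bq.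
pose al : multinom d := Multinom [tuple count_mem i w | i < d].
have alE i : al i = count_mem i w by rewrite /al multinomE tnth_mktuple.
have adeg : mdeg al = r.
  rewrite mdegE -wr; under eq_bigr do rewrite alE.
  elim: (w) => [|j w' IH] /=; first by rewrite big1.
  rewrite big_split /= IH (bigD1 j) //= eqxx big1 // => i.
  by rewrite eq_sym => /negbTE ->.
have aw : dword w F = mpartial al F.
  rewrite mpartial_word; apply: dword_perm; first by rewrite wr.
  by apply/allP => i _ /=; rewrite count_mword alE.
have alr : (mdeg al < r.+1)%N by rewrite adeg.
have hle : (holder0_seminorm 1 B (mpartial al F) <= H%:E)%E.
  rewrite -HE /holder_seminorm.
  rewrite (bigD1 (BMultinom alr)) /=; last by rewrite adeg.
  by rewrite le_max lexx.
have [->|pq] := eqVneq p q; first by rewrite !subrr normr0 enorm0 mulr0.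
have e0 : 0 < enorm (p - q) by rewrite enorm_gt0 subr_eq0.
have : ((`|dword w F p - dword w F q| / enorm (p - q) `^ 1)%:E <= H%:E)%E.
  apply: le_trans hle; rewrite aw; apply: ereal_sup_ubound; right.
  by exists (p, q).
by rewrite lee_fin powRr1 ?enorm_ge0 // ler_pdivrMr.
Qed.

End Geometry.

(** * The error functional *)

Section ErrorFunctional.
Context {R : realType} {d k n N : nat}.
Variables (a : bmultinom d k.+1 -> 'rV[R]_d -> R) (z : 'rV[R]_d).
Variable x : 'I_N -> 'rV[R]_d.

Notation site := (seq 'I_d * 'rV[R]_d)%type.

Definition point_list (c : 'I_N -> R) : seq (R * site) :=
  [seq (c j, ([::], x j)) | j <- index_enum 'I_N].

Definition diffop_list : seq (R * site) :=
  [seq (a al z, (mword al, z)) | al <- index_enum (bmultinom d k.+1)].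

Definition error_list (w : 'I_N -> R) : seq (R * site) :=
  diffop_list ++ point_list (fun j => - w j).

Lemma app_point_list F c : app F (point_list c) = \sum_j c j * F ([::], x j).
Proof. by rewrite /app big_map. Qed.

Lemma app_diffop_list F :
  app F diffop_list = \sum_al a al z * F (mword al, z).
Proof. by rewrite /app big_map. Qed.

Lemma diffopE g : diffop a g z = app (dsite g) diffop_list.
Proof.
rewrite app_diffop_list; apply: eq_bigr => al _.
by rewrite mpartial_word.
Qed.

Lemma app_error_list F w : app F (error_list w) =
  app F diffop_list - \sum_j w j * F ([::], x j).
Proof.
rewrite app_cat app_point_list; congr (_ + _).
by rewrite -sumrN; apply: eq_bigr => j _; rewrite mulNr.
Qed.

Lemma error_listE g w :
  diffop a g z - \sum_j w j * g (x j) = app (dsite g) (error_list w).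
Proof. by rewrite app_error_list diffopE. Qed.

Lemma size_error_list w : (k <= n)%N -> forall b, b \in error_list w ->
  (size b.2.1 <= n)%N.
Proof.
move=> kn b; rewrite mem_cat => /orP[] /mapP[i _ ->] //=.
by rewrite size_mword; apply: leq_trans kn; rewrite -ltnS; exact: bmdeg.
Qed.

(** Exactness replaces [F] by its Taylor remainder at [z], which has zero derivatives there up to
    order [n], so that only the nodes contribute. *)
Lemma exact_error_list w F : (k <= n)%N ->
  (forall p, inPi n.+1 p -> diffop a (peval p) z = \sum_j w j * peval p (x j)) ->
  symw n (fun v => F (v, z)) ->
  app F (error_list w) = \sum_j - w j * trem n z (x j - z) F.
Proof.
move=> kn ex symF; rewrite app_error_list app_diffop_list.
have := @exact_taylor R d N n z (fun p => diffop a (peval p) z) x w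
  _ (fun al => a al z) mword (fun v => F (v, z)).
move=> -> //.
- rewrite -sumrB; apply: eq_bigr => j _.
  by rewrite /trem [z + _]addrC subrK; ring.
- by move=> p; rewrite diffopE app_diffop_list.
- by move=> al; rewrite size_mword; apply: leq_trans kn; rewrite -ltnS; exact: bmdeg.
Qed.

Section Bound.
Variables (Phi : 'rV[R]_d -> R) (w : 'I_N -> R).
Hypothesis Phi_Cr : Cr (2 * n) Phi.
Hypothesis Phi_even : forall y, Phi (- y) = Phi y.
Hypothesis kn : (k <= n)%N.
Hypothesis w_exact : forall p, inPi n.+1 p ->
  diffop a (peval p) z = \sum_j w j * peval p (x j).

Notation K := (dkernel Phi).

Lemma bil_error_list : bil K (error_list w) (error_list w) =
  \sum_i - w i * trem n z (x i - z)
    (fun t => \sum_j - w j * trem n z (x j - z) (K t)).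
Proof.
have E t : (size t.1 <= n)%N -> app (K t) (error_list w) =
    \sum_j - w j * trem n z (x j - z) (K t).
  by move=> tn; apply: exact_error_list => // v v' vn vv'; exact: (dkernel_perm Phi_Cr).
rewrite bilE; transitivity (app (fun t => \sum_j - w j * trem n z (x j - z) (K t)) (error_list w)).
  by apply: eq_app => b /(size_error_list kn) bn; rewrite E.
apply: exact_error_list => // v v' vn vv'.
have v'n : (size v' <= n)%N by rewrite -(perm_size vv').
apply: eq_bigr => j _; congr (_ * _); apply: eq_trem => t tn.
by rewrite !(@dkernel_sym _ _ n _ Phi_Cr Phi_even _ t) //; exact: (dkernel_perm Phi_Cr).
Qed.

(** For a vanishing growth function, where the Hölder semi-norm may be infinite and gives no
    estimate. *)
Lemma bil_error_list0 : (forall j, w j * enorm (x j - z) = 0) ->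
  bil K (error_list w) (error_list w) = 0.
Proof.
move=> w0; rewrite bil_error_list big1 // => i _.
have /eqP := w0 i; rewrite mulf_eq0 => /orP[/eqP ->|/eqP h]; first by rewrite oppr0 mul0r.
have -> : x i - z = 0.
  by apply/eqP; rewrite -[_ == _]negbK -enorm_gt0 h ltxx.
by rewrite trem0 mulr0.
Qed.

Lemma bil_error_list_le (H rho : R) : 0 <= H ->
  (forall v p q, size v = (2 * n)%N -> star_ball z x p -> star_ball z x q ->
     `|dword v Phi p - dword v Phi q| <= H * enorm (p - q)) ->
  \sum_j `|w j| * enorm (x j - z) `^ (n%:R + 2^-1) <= rho ->
  bil K (error_list w) (error_list w) <= C_d_2n d n * H * rho ^+ 2.
Proof.
move=> H0 lip wrho; rewrite bil_error_list.
pose e j := enorm (x j - z) ^+ n * Num.sqrt (enorm (x j - z)).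
have e0 j : 0 <= e j by rewrite mulr_ge0 ?sqrtr_ge0 ?exprn_ge0 ?enorm_ge0.
have C0 : 0 <= C_d_2n d n :> R.
  apply: divr_ge0; first by rewrite mulr_ge0 // exprn_ge0.
  by apply: prodr_ge0 => i _; exact: sqr_ge0.
have key i j : trem n z (x i - z) (fun t => trem n z (x j - z) (K t)) * (w i * w j)
    <= C_d_2n d n * H * (`|w i| * e i) * (`|w j| * e j).
  apply: (le_trans (ler_norm _)); rewrite normrM.
  have := @trem_trem_bound R d n Phi Phi_Cr Phi_even z (star_ball z x) H H0 lip
    (x i - z) (x j - z) (fun s t => @star_ball_sub R d N z x i j s t).
  move=> hb; rewrite normrM.
  have -> : C_d_2n d n * H * (`|w i| * e i) * (`|w j| * e j) =
      C_d_2n d n * H * (e i * e j) * (`|w i| * `|w j|) by ring.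
  apply: ler_wpM2r; first by rewrite mulr_ge0.
  apply: (le_trans hb).
  rewrite sqrtrM ?enorm_ge0 // /C_d_2n prodrXl.
  set P := \prod_(1 <= i < n.+1) _.
  have P0 : 0 <= (P ^+ 2)^-1 by rewrite invr_ge0 sqr_ge0.
  have -> : 2 * d%:R ^+ n / P ^+ 2 * H * (e i * e j) =
    2 * H * (d%:R ^+ n * (enorm (x i - z) ^+ n * enorm (x j - z) ^+ n)) *
      (Num.sqrt (enorm (x i - z)) * Num.sqrt (enorm (x j - z))) / P ^+ 2.
    by rewrite /e; ring.
  apply: ler_wpM2r => //; apply: ler_wpM2r; first by rewrite mulr_ge0 ?sqrtr_ge0.
  by apply: ler_wpM2l; [rewrite mulr_ge0|exact: sum_abs_expr_le].
(* Each pair is bounded by a product of one factor per node, so the double sum becomes a square. *)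
apply: (@le_trans _ _ (\sum_i \sum_j C_d_2n d n * H * (`|w i| * e i) * (`|w j| * e j))).
  apply: ler_sum => i _; rewrite trem_sum mulr_sumr; apply: ler_sum => j _.
  by apply: le_trans (key i j); rewrite le_eqVlt; apply/orP; left; apply/eqP; ring.
under eq_bigr do rewrite -mulr_sumr.
rewrite -mulr_suml -mulr_sumr -mulrA -expr2.
have S0 : 0 <= \sum_i `|w i| * e i by apply: sumr_ge0 => i _; rewrite mulr_ge0.
have Srho : \sum_i `|w i| * e i <= rho.
  apply: le_trans wrho; apply: ler_sum => i _.
  by rewrite powR_half ?enorm_ge0.
apply: ler_wpM2l; first by rewrite mulr_ge0.
by rewrite lerXn2r ?nnegrE // (le_trans S0).
Qed.

End Bound.
End ErrorFunctional.

(** * Error of the kernel-based formula on the native space *)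

Section NativeError.
Context {R : realType} {d n : nat}.
Variable Phi : 'rV[R]_d -> R.

Notation site := (seq 'I_d * 'rV[R]_d)%type.
Notation K := (dkernel Phi).

Hypothesis Phi_Cr : Cr (2 * n) Phi.
Hypothesis Phi_even : forall y, Phi (- y) = Phi y.

Lemma native_functional s M (p : 'I_M -> mpoly d R) g C
    (L : seq (R * site)) : basis_Pi s p ->
  native_bound (fun u v => Phi (u - v)) s g C ->
  (forall b, b \in L -> (size b.2.1 <= n)%N) ->
  (forall i, app (dsite (peval (p i))) L = 0) ->
  `|app (dsite g) L| <= C * Num.sqrt (bil K L L).
Proof.
move=> [_ _ pspan] [C0 gC] SL pL.
have [|_ B] := @native_smooth R d n C [seq p i | i <- enum 'I_M] K g C0
  (dkernel_smooth Phi_Cr Phi_even).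
  move=> L' SL' pL'.
  have nilL (b : R * site) : b \in L' -> b.2 = ([::], b.2.2).
    by move=> /SL'; rewrite leqn0 => /nilP; case: b => c [v y] /= ->.
  pose y (i : 'I_(size L')) := (tnth (in_tuple L') i).2.2.
  pose c (i : 'I_(size L')) := (tnth (in_tuple L') i).1.
  have appE F : app F L' = \sum_i c i * F ([::], y i).
    rewrite /app big_tnth; apply: eq_bigr => i _.
    by rewrite {1}(nilL (tnth (in_tuple L') i)) // mem_tnth.
  have := gC _ y c; rewrite appE bilE appE.
  have -> : \sum_i c i * app (K ([::], y i)) L' =
      \sum_i \sum_j c i * c j * Phi (y i - y j).
    apply: eq_bigr => i _; rewrite appE mulr_sumr; apply: eq_bigr => j _.
    by rewrite /dkernel /= mul1r mulrA.
  apply=> r /pspan[b ->].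
  transitivity (\sum_i b i * app (dsite (peval (p i))) L').
    under [RHS]eq_bigr do rewrite appE mulr_sumr.
    rewrite exchange_big; apply: eq_bigr => i _.
    rewrite peval_sum mulr_sumr; apply: eq_bigr => m _.
    by rewrite pevalZ /dsite /=; ring.
  by rewrite big1 // => m _; rewrite pL' ?mulr0 // map_f ?mem_enum.
by apply: B => // q /mapP[i _ ->].
Qed.

Context {k N : nat}.
Variables (a : bmultinom d k.+1 -> 'rV[R]_d -> R) (z : 'rV[R]_d).
Variable x : 'I_N -> 'rV[R]_d.
Hypothesis kn : (k <= n)%N.

(* Adding [c = wq - w] to the weights [w] changes the quadratic form by
   [bil K c c] because [w] is a critical point. Positive definiteness of the
   kernel is not needed: if [bil K c c < 0], the definition of the native space
   makes [g] vanish on [c]. *)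
Lemma native_error_le s M (p : 'I_M -> mpoly d R) g C w v wq :
  basis_Pi s p -> native_bound (fun u y => Phi (u - y)) s g C ->
  kernel_formula a (fun u y => Phi (u - y)) p z x w v ->
  (forall i, \sum_j wq j * peval (p i) (x j) = diffop a (peval (p i)) z) ->
  `|diffop a g z - \sum_j w j * g (x j)| <=
    C * Num.sqrt (bil K (error_list a z x wq) (error_list a z x wq)).
Proof.
move=> hp gC [hw1 hw2] hwq; have C0 := gC.1.
set Lq := error_list a z x wq.
pose L := error_list a z x w; pose c j := wq j - w j.
pose Lc : seq (R * site) := point_list x c.
have appE F : app F L = app F Lq + app F Lc.
  rewrite !app_error_list app_point_list -addrA; congr (_ + _).
  by rewrite -!sumrN -big_split; apply: eq_bigr => j _; rewrite /c /=; ring.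
have pL i : app (dsite (peval (p i))) L = 0.
  by rewrite -error_listE -hw2 subrr.
have pq i : app (dsite (peval (p i))) Lq = 0.
  by rewrite -error_listE -hwq subrr.
have pc i : app (dsite (peval (p i))) Lc = 0.
  by have := appE (dsite (peval (p i))); rewrite pL pq add0r.
(* By the first group of equations the form between a node and the error functional is the value
   there of the polynomial with coefficients [v], and [Lc] annihilates polynomials. *)
have bil_cL : bil K Lc L = 0.
  rewrite bilE app_point_list.
  rewrite (eq_bigr (fun i => c i * \sum_j v j * peval (p j) (x i))); last first.
    move=> i _; congr (_ * _); rewrite app_error_list app_diffop_list.
    have -> : \sum_al a al z * K ([::], x i) (mword al, z) =
        diffop a (fun y => Phi (y - x i)) z.
      apply: eq_bigr => al _; rewrite mpartial_word dword_shift; congr (_ * _).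
      rewrite (@dkernel_sym _ _ n _ Phi_Cr Phi_even) //=; last first.
        by rewrite size_mword; apply: leq_trans kn; rewrite -ltnS; exact: bmdeg.
      by rewrite /dkernel /= cats0 mul1r.
    rewrite -hw1 addrAC (eq_bigr (fun j => w j * K ([::], x i) ([::], x j))).
      by rewrite subrr add0r.
    by move=> j _; rewrite /dkernel /= mul1r.
  under eq_bigr do rewrite mulr_sumr.
  rewrite exchange_big big1 // => m _.
  have := pc m; rewrite app_point_list => h.
  transitivity (v m * \sum_j c j * dsite (peval (p m)) ([::], x j)).
    by rewrite mulr_sumr; apply: eq_bigr => i _; rewrite /dsite /=; ring.
  by rewrite h mulr0.
have bil_swap (L1 L2 : seq (R * site)) :
    (forall b, b \in L1 -> (size b.2.1 <= n)%N) ->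
    (forall b, b \in L2 -> (size b.2.1 <= n)%N) -> bil K L1 L2 = bil K L2 L1.
  move=> h1 h2; rewrite !bil_sums exchange_big /=.
  apply: eq_big_seq => b bL; apply: eq_big_seq => b' b'L.
  congr (_ * _); first exact: mulrC.
  by apply: (dkernel_sym Phi_Cr Phi_even); [exact: h1|exact: h2].
have sL b : b \in L -> (size b.2.1 <= n)%N by exact: (size_error_list kn).
have sc b : b \in Lc -> (size b.2.1 <= n)%N by move=> /mapP[j _ ->].
have bilE' : bil K Lq Lq = bil K L L + bil K Lc Lc.
  have E F : app F Lq = app F L - app F Lc by rewrite appE addrK.
  have E2 L1 : bil K L1 Lq = bil K L1 L - bil K L1 Lc.
    rewrite !bilE -[- app _ _]mulN1r -appZ -appD; apply: eq_app => b _.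
    by rewrite E mulN1r.
  have E1 L2 : bil K Lq L2 = bil K L L2 - bil K Lc L2 by rewrite !bilE E.
  have sw : bil K L Lc = 0 by rewrite (bil_swap L Lc sL sc).
  by rewrite E2 !E1 bil_cL sw !subr0 sub0r opprK.
rewrite error_listE -/L.
have [cc|cc] := leP 0 (bil K Lc Lc).
  apply: le_trans (native_functional hp gC (size_error_list kn) pL) _.
  by rewrite ler_wpM2l // ler_wsqrtr // bilE' lerDl.
have gc : app (dsite g) Lc = 0.
  have := native_functional hp gC sc pc.
  by rewrite (ler0_sqrtr (ltW cc)) mulr0 normr_le0 => /eqP.
by rewrite appE gc addr0; exact: (native_functional hp gC (size_error_list kn) pq).
Qed.

End NativeError.

(** Finiteness of the growth function is the hypothesis of [weight_duality] for the evaluations at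
    the nodes; the value is nonnegative because the zero polynomial is admissible. *)
Lemma growth_weights (R : realType) (d k N q : nat)
    (a : bmultinom d k.+1 -> 'rV[R]_d -> R) (z : 'rV[R]_d)
    (x : 'I_N -> 'rV[R]_d) (mu : R) :
  (growth q a z x mu < +oo)%E ->
  exists2 rho : R, 0 <= rho /\ growth q a z x mu = rho%:E &
    exists w : 'I_N -> R, (forall p, inPi q p ->
        diffop a (peval p) z = \sum_j w j * peval p (x j)) /\
      \sum_j `|w j| * enorm (x j - z) `^ mu <= rho.
Proof.
move=> gfin; set g := growth q a z x mu in gfin *.
have lin c (u v : mpoly d R) : diffop a (peval (c *: u + v)) z =
    c * diffop a (peval u) z + diffop a (peval v) z.
  rewrite /diffop mulr_sumr -big_split; apply: eq_bigr => al _ /=.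
  have E v' : foldr (@mderiv d R) (c *: u + v) v' =
      c *: foldr (@mderiv d R) u v' + foldr (@mderiv d R) v v'.
    by elim: v' => //= i v' ->; rewrite mderivD mderivZ.
  by rewrite !mpartial_word !dword_peval E pevalD /= pevalZ; ring.
have le_g p : inPi q p -> (forall j, `|peval p (x j)| <= enorm (x j - z) `^ mu) ->
    ((diffop a (peval p) z)%:E <= g)%E.
  by move=> pq pb; apply: ereal_sup_ubound; exists p.
have d0 : diffop a (peval 0) z = 0.
  by have := lin 1 0 0; rewrite scale1r addr0 mul1r; lra.
have g0 : (0 <= g)%E.
  rewrite -[X in (X%:E <= _)%E]d0; apply: le_g; first exact: inPi0.
  by move=> j; rewrite /peval meval0 normr0 powR_ge0.
have gE : g = (fine g)%:E by rewrite fineK // ge0_fin_numE.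
exists (fine g); first by rewrite fine_ge0.
apply: (@weight_duality R _ (inPi q)) => //.
- exact: inPi0.
- by move=> c u v uq vq; apply: inPiD => //; exact: inPiZ.
- by move=> j c u v _ _; rewrite pevalD /= pevalZ.
- by move=> j; exact: powR_ge0.
- by move=> p pq pb; rewrite -lee_fin -gE; exact: le_g.
Qed.

Unset Implicit Arguments.
Set Strict Implicit.
Set Printing Implicit Defensive.

Theorem corollary5 (R : realType) (d k n s N M : nat)
    (hd : (0 < d)%N) (hkn : (k <= n)%N)
    (a : bmultinom d k.+1 -> 'rV[R]_d -> R)
    (z : 'rV[R]_d) (x : 'I_N -> 'rV[R]_d) (hx : injective x)
    (hex : (0 < s)%N -> exists w : 'I_N -> R,
       forall p : mpoly d R, inPi s p ->
         \sum_j w j * peval p (x j) = diffop a (peval p) z)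
    (p : 'I_M -> mpoly d R) (hp : basis_Pi s p)
    (w : 'I_N -> R) (v : 'I_M -> R)
    (hw : kernel_formula a (wendland_kernel n) p z x w v)
    (f : 'rV[R]_d -> R) (hf : native_space (wendland_kernel n) s f) :
  let rho := growth (maxn s n.+1) a z x (n%:R + 2^-1) in
  (rho < +oo)%E ->
  (`|diffop a f z - \sum_j w j * f (x j)|%:E
    <= rho * (Num.sqrt (C_d_2n d n))%:E
       * sqrte (holder_seminorm (2 * n) 1 (star_ball z x) (wendland n))
       * (native_norm (wendland_kernel n) s f)%:E)%E.
Proof.
move=> rho0 rho_fin.
have [rho [rho_ge0 rhoE] [wq [wq_exact wq_le]]] := growth_weights rho_fin.
rewrite /rho0 rhoE {rho0 rho_fin}.
set hol := holder_seminorm _ _ _ _; set nn := native_norm _ _ _.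
have cPhi := @wendland_Cr R d n.
have ePhi (y : 'rV[R]_d) : wendland n (- y) = wendland n y.
  by rewrite /wendland enormN.
set Phi : 'rV[R]_d -> R := wendland n in cPhi ePhi hol *.
set Q := bil (dkernel Phi) (error_list a z x wq) (error_list a z x wq).
set err := `|_|.
have err_C C : native_bound (wendland_kernel n) s f C -> err <= C * Num.sqrt Q.
  move=> fC; apply: (native_error_le cPhi ePhi hkn hp fC hw) => i.
  rewrite wq_exact //; apply: inPi_le (leq_maxl s n.+1) _.
  by case: hp.
have nn_ge0 : 0 <= nn.
  by apply: lb_le_inf => // C [].
have err_nn : err <= nn * Num.sqrt Q.
  (* The infimum over [C] is compared after division by [Num.sqrt Q]; if that is 0, a single
     admissible [C] settles the matter. *)
  have [Q0|Q0] := leP (Num.sqrt Q) 0.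
    have Qz : Num.sqrt Q = 0 by apply/eqP; rewrite eq_le Q0 sqrtr_ge0.
    by case: hf => C /err_C; rewrite Qz !mulr0.
  rewrite -ler_pdivrMr //; apply: lb_le_inf => // C /err_C.
  by rewrite ler_pdivrMr.
have wq_exactn q : inPi n.+1 q -> diffop a (peval q) z = \sum_j wq j * peval q (x j).
  by move=> qn; apply: wq_exact; exact: inPi_le (leq_maxr s n.+1) qn.
have Cd_gt0 : 0 < C_d_2n d n :> R.
  rewrite divr_gt0 ?mulr_gt0 ?exprn_gt0 ?ltr0n //.
  by apply: prodr_gt0 => i _; rewrite exprn_gt0 // ltr_wpDr // invr_gt0.
have hol_ge0 : (0 <= hol)%E.
  rewrite /hol /holder_seminorm; elim/big_ind: _ => // [u1 u2 h1 h2|al _].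
    by rewrite le_max h1.
  by apply: ereal_sup_ubound; left.
have rhs_ge0 : (0 <= rho%:E * (Num.sqrt (C_d_2n d n))%:E * sqrte hol * nn%:E)%E.
  by rewrite !mule_ge0 ?lee_fin ?sqrtr_ge0 ?sqrte_ge0.
have [nn0|nn_neq0] := eqVneq nn 0.
  by apply: le_trans rhs_ge0; rewrite lee_fin; move: err_nn; rewrite nn0 mul0r.
(* With [rho = 0] every node has weight 0 or coincides with [z], so the form vanishes. *)
have [rho_eq0|rho_neq0] := eqVneq rho 0.
  suff Q0 : Q = 0.
    by apply: le_trans rhs_ge0; rewrite lee_fin; move: err_nn; rewrite Q0 sqrtr0 mulr0.
  apply: (bil_error_list0 cPhi ePhi hkn wq_exactn) => j.
  have /eqP : `|wq j| * enorm (x j - z) `^ (n%:R + 2^-1) = 0.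
    apply/eqP; rewrite eq_le mulr_ge0 ?powR_ge0 // andbT -rho_eq0.
    apply: le_trans wq_le; rewrite (bigD1 j) //= lerDl.
    by apply: sumr_ge0 => i _; rewrite mulr_ge0 ?powR_ge0.
  rewrite mulf_eq0 normr_eq0 => /orP[/eqP ->|]; first by rewrite mul0r.
  by rewrite powR_eq0 => /andP[/eqP -> _]; rewrite mulr0.
have nn_gt0 : 0 < nn by rewrite lt_neqAle eq_sym nn_neq0.
have rho_gt0 : 0 < rho by rewrite lt_neqAle eq_sym rho_neq0.
case E : hol hol_ge0 => [H| |] // H0; last first.
  have -> : sqrte +oo = +oo%E :> \bar R by [].
  rewrite -EFinM gt0_muley ?lte_fin ?mulr_gt0 ?sqrtr_gt0 //.
  by rewrite gt0_mulye ?lte_fin // leey.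
rewrite lee_fin in H0.
have -> : sqrte H%:E = (Num.sqrt H)%:E by [].
rewrite -!EFinM lee_fin mulrC; apply: (le_trans err_nn).
rewrite ler_wpM2l //.
have lip u q1 q2 : size u = (2 * n)%N -> star_ball z x q1 -> star_ball z x q2 ->
    `|dword u Phi q1 - dword u Phi q2| <= H * enorm (q1 - q2).
  by move=> un; exact: holder_lipschitz cPhi E un.
have := bil_error_list_le cPhi ePhi hkn wq_exactn H0 lip wq_le.
rewrite -/Q => /ler_wsqrtr; rewrite sqrtrM; last by rewrite mulr_ge0 // ltW.
rewrite sqrtr_sqr ger0_norm // sqrtrM; last exact: ltW.
by rewrite mulrC mulrA.
Qed.
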